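(* Let $D$ be a connected locally-finite digraph with exactly two ends. Then $D$ is connected-homogeneous if and only if it is isomorphic to $J(r)$ for some $r\in\mathbb{N}$.
   Context: A digraph is a set with an irreflexive antisymmetric arc relation $\to$; connectivity and ends refer to the underlying undirected graph (ends of a connected locally-finite graph are equivalence classes of rays, two rays being equivalent if some third ray meets each infinitely often). Locally-finite: every vertex has finitely many in- and out-neighbours. Connected-homogeneous: every isomorphism between finite connected induced subdigraphs extends to an automorphism. For $r\in\mathbb{N}$, $J(r)$ is the digraph with vertex set $\mathbb{Z}\times\{1,\dots,r\}$ and arcs $(i,x)\to(i+1,y)$ for all $i\in\mathbb{Z}$ and $x,y\in\{1,\dots,r\}$. *)

(* Defs.v *)
From Stdlib Require Import ZArith Arith List Relations.

Section Digraphs.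

Variable V : Type.
Variable arc : V -> V -> Prop.

Definition is_digraph : Prop :=
  (forall x, ~ arc x x) /\ (forall x y, arc x y -> ~ arc y x).

Definition adj (x y : V) : Prop := arc x y \/ arc y x.

Definition finite_pred (A : V -> Prop) : Prop :=
  exists l : list V, forall x, A x -> In x l.

Definition locally_finite : Prop :=
  forall x, finite_pred (fun y => arc x y) /\ finite_pred (fun y => arc y x).

Definition connected : Prop :=
  forall x y : V, clos_refl_trans V adj x y.

Definition adj_in (A : V -> Prop) (x y : V) : Prop := A x /\ A y /\ adj x y.

Definition induced_connected (A : V -> Prop) : Prop :=
  forall x y, A x -> A y -> clos_refl_trans V (adj_in A) x y.

Definition induced_iso (A B : V -> Prop) (f : V -> V) : Prop :=
  (forall x, A x -> B (f x)) /\
  (forall x y, A x -> A y -> f x = f y -> x = y) /\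
  (forall y, B y -> exists x, A x /\ f x = y) /\
  (forall x y, A x -> A y -> (arc x y <-> arc (f x) (f y))).

Definition automorphism (g : V -> V) : Prop :=
  (exists h : V -> V, (forall x, h (g x) = x) /\ (forall y, g (h y) = y)) /\
  (forall x y, arc x y <-> arc (g x) (g y)).

Definition connected_homogeneous : Prop :=
  forall (A B : V -> Prop) (f : V -> V),
    finite_pred A -> finite_pred B ->
    induced_connected A -> induced_connected B ->
    induced_iso A B f ->
    exists g : V -> V, automorphism g /\ (forall x, A x -> g x = f x).

Definition ray (r : nat -> V) : Prop :=
  (forall m n, r m = r n -> m = n) /\ (forall n, adj (r n) (r (S n))).

(* The ray s meets the ray r infinitely often (s is injective, so this means
   infinitely many common vertices). *)
Definition meets_inf (s r : nat -> V) : Prop :=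
  forall N, exists n m, (N <= n)%nat /\ s n = r m.

Definition ray_equiv (r1 r2 : nat -> V) : Prop :=
  exists s, ray s /\ meets_inf s r1 /\ meets_inf s r2.

Definition has_exactly_two_ends : Prop :=
  exists r1 r2, ray r1 /\ ray r2 /\ ~ ray_equiv r1 r2 /\
    forall r, ray r -> ray_equiv r r1 \/ ray_equiv r r2.

End Digraphs.
Arguments is_digraph {V}. Arguments adj {V}. Arguments finite_pred {V}. Arguments locally_finite {V}. Arguments connected {V}. Arguments adj_in {V}. Arguments induced_connected {V}. Arguments induced_iso {V}. Arguments automorphism {V}. Arguments connected_homogeneous {V}. Arguments ray {V}. Arguments meets_inf {V}. Arguments ray_equiv {V}. Arguments has_exactly_two_ends {V}.

Definition digraph_iso {V W : Type} (arcV : V -> V -> Prop) (arcW : W -> W -> Prop)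
  (f : V -> W) : Prop :=
  (exists h : W -> V, (forall x, h (f x) = x) /\ (forall y, f (h y) = y)) /\
  (forall x y, arcV x y <-> arcW (f x) (f y)).

Definition isomorphic {V W : Type} (arcV : V -> V -> Prop) (arcW : W -> W -> Prop) : Prop :=
  exists f : V -> W, digraph_iso arcV arcW f.

Definition Jvert (r : nat) : Type := (Z * { x : nat | (1 <= x <= r)%nat })%type.

Definition Jarc (r : nat) (u v : Jvert r) : Prop := fst v = (fst u + 1)%Z.

(* Main.v *)
(**
In a two-ended vertex-transitive graph a ball of large radius about [x] separates the ends. Let
[w x v] be 1, -1 or 0 according to whether [v] lies on the side of the first end, of the second
end, or of neither. An automorphism fixes or exchanges the ends, so it preserves [w] up to a
global sign, and [D x y = sum_v (w x v - w y v)] is a cocycle preserved up to sign. Points far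
apart have nested sides, whence [D] has finite fibres. By arc-transitivity [D] is [d] or [-d] on
every arc, with [d] nonzero; then there are no triangles, all directed 2-paths are equivalent
under automorphisms, and this forces the sign to be the same on all arcs. So the digraph is
layered over Z with finite layers.

In a layered connected-homogeneous digraph, suppose no two vertices have the same in-neighbours.
An automorphism fixing a layer pointwise then fixes everything above it, contradicting the
freedom to exchange two children of a vertex high above. So in-twins exist whenever some vertex
has two children, and homogeneity makes all siblings in-twins. Replacing a vertex by an in-twin
while fixing what is below shows that siblings also have the same out-neighbours. With the dual
statements, consecutive layers are completely joined.

Conversely, an isomorphism between finite connected subdigraphs of J(r) shifts all layers by the
same amount, so it extends layer by layer.
*)

Require Import Defs.
From Stdlib Require Import ZArith Arith List Relations Lia Permutation.
From Stdlib Require Import Classical ClassicalEpsilon ProofIrrelevance.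
From Stdlib Require Import PropExtensionality FunctionalExtensionality.
Import ListNotations.

Definition dec (P : Prop) : {P} + {~ P} := excluded_middle_informative P.

(** * Finite predicates *)

Section FinitePredicates.

Context {V : Type}.
Implicit Types A B : V -> Prop.

Lemma finite_sub A B : (forall x, A x -> B x) -> finite_pred B -> finite_pred A.
Proof. intros H [l Hl]. exists l. auto. Qed.

Lemma finite_or A B : finite_pred A -> finite_pred B -> finite_pred (fun x => A x \/ B x).
Proof.
  intros [l Hl] [m Hm]. exists (l ++ m). intros x [H|H]; apply in_or_app; auto.
Qed.

Lemma finite_eq (a : V) : finite_pred (fun x => x = a).
Proof. exists [a]. intros x ->. now left. Qed.

Lemma finite_bind {W : Type} (A : W -> Prop) (R : W -> V -> Prop) :
  finite_pred A -> (forall a, A a -> finite_pred (R a)) ->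
  finite_pred (fun y => exists a, A a /\ R a y).
Proof.
  intros [l Hl] HR.
  assert (H : finite_pred (fun y => exists a, In a l /\ A a /\ R a y)).
  { clear Hl. induction l as [|a l IH].
    - exists []. intros y [a [[] _]].
    - destruct (dec (A a)) as [Ha|Ha].
      + apply finite_sub with (B := fun y => R a y \/ exists b, In b l /\ A b /\ R b y).
        * intros y [b [[->|Hb] [H1 H2]]]; [now left|right; eauto].
        * apply finite_or; auto.
      + apply finite_sub with (2 := IH).
        intros y [b [[->|Hb] [H1 H2]]]; [contradiction|eauto]. }
  apply finite_sub with (2 := H). intros y [a [Ha Hy]]. eauto.
Qed.

Lemma finite_preimage {W : Type} (A : W -> Prop) (g : V -> W) (h : W -> V) :
  (forall x, h (g x) = x) -> finite_pred A -> finite_pred (fun x => A (g x)).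
Proof.
  intros Hh [l Hl]. exists (map h l). intros x Hx.
  rewrite <- (Hh x). apply in_map. auto.
Qed.

(** [finite_pred] only provides a list covering the set; sums and counting need one that lists it
    exactly and without repetition. *)
Lemma finite_enum A : finite_pred A -> exists l, NoDup l /\ forall x, In x l <-> A x.
Proof.
  intros [l Hl].
  exists (nodup (fun x y => dec (x = y)) (filter (fun x => if dec (A x) then true else false) l)).
  split; [apply NoDup_nodup|]. intros x. rewrite nodup_In, filter_In.
  destruct (dec (A x)); intuition; discriminate.
Qed.

Lemma NoDup_map_injective {W : Type} (f : V -> W) l x y :
  NoDup (map f l) -> In x l -> In y l -> f x = f y -> x = y.
Proof.
  induction l as [|a l IH]; simpl; [tauto|].
  intros Hn [->|Hx] [->|Hy] E; inversion Hn; subst; auto.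
  - exfalso. apply H1. rewrite E. now apply in_map.
  - exfalso. apply H1. rewrite <- E. now apply in_map.
Qed.

Lemma injective_avoids_list (r : nat -> V) (l : list V) :
  (forall m n, r m = r n -> m = n) -> exists N, forall k, N <= k -> ~ In (r k) l.
Proof.
  intros Hr. induction l as [|a l [N IH]].
  - exists 0. auto.
  - destruct (classic (exists k, r k = a)) as [[k Hk]|H].
    + exists (Nat.max N (S k)). intros j Hj [E|E].
      * rewrite <- Hk in E. apply Hr in E. lia.
      * apply (IH j); auto; lia.
    + exists N. intros j Hj [E|E]; [eauto|apply (IH j); auto].
Qed.

(** Used to cut a path at the last place where it meets a ray, after which the ray is free of the
    path. *)
Lemma max_index_in_list (r : nat -> V) (l : list V) (m : nat) :
  (forall m n, r m = r n -> m = n) -> In (r m) l ->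
  exists k, m <= k /\ In (r k) l /\ forall j, k < j -> ~ In (r j) l.
Proof.
  intros Hr Hm. destruct (injective_avoids_list r l Hr) as [N HN].
  assert (H : forall d m, N <= m + d -> In (r m) l ->
    exists k, m <= k /\ In (r k) l /\ forall j, k < j -> ~ In (r j) l).
  { clear m Hm. induction d as [|d IH]; intros m Hd Hm.
    - exfalso. apply (HN m); auto. lia.
    - destruct (classic (exists j, m < j /\ In (r j) l)) as [[j [Hj Hin]]|Hno].
      + destruct (IH j) as [k [H1 [H2 H3]]]; [lia|auto|]. exists k. repeat split; auto. lia.
      + exists m. repeat split; auto. intros j Hj Hin. apply Hno. eauto. }
  apply (H N m); auto. lia.
Qed.

(** The clause on [combine] records that entries in equal positions are matched, so part of the
    bijection can be prescribed by ordering the lists. The defaults [w0] and [v0] only serve outside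
    the lists. *)
Lemma list_bijection {W : Type} (l : list V) (m : list W) (w0 : W) (v0 : V) :
  NoDup l -> NoDup m -> length l = length m ->
  exists (b : V -> W) (c : W -> V),
    (forall x, In x l -> In (b x) m /\ c (b x) = x) /\
    (forall y, In y m -> In (c y) l /\ b (c y) = y) /\
    (forall x y, In (x, y) (combine l m) -> b x = y).
Proof.
  revert m. induction l as [|a l IH]; intros [|a' m] Hl Hm Hlen; try discriminate.
  - exists (fun _ => w0), (fun _ => v0). simpl. tauto.
  - inversion Hl; inversion Hm; subst.
    destruct (IH m) as [b [c [Hb [Hc Hbc]]]]; auto.
    exists (fun x => if dec (x = a) then a' else b x),
           (fun y => if dec (y = a') then a else c y).
    repeat split.
    + destruct (dec (x = a)); [now left|]. right. destruct H as [H|H]; [congruence|]. now apply Hb.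
    + destruct (dec (x = a)) as [->|Hx].
      * destruct (dec (a' = a')); congruence.
      * destruct H as [H|H]; [congruence|]. destruct (Hb x H).
        destruct (dec (b x = a')); congruence.
    + destruct (dec (y = a')); [now left|]. right. destruct H as [H|H]; [congruence|]. now apply Hc.
    + destruct (dec (y = a')) as [->|Hx].
      * destruct (dec (a = a)); congruence.
      * destruct H as [H|H]; [congruence|]. destruct (Hc y H).
        destruct (dec (c y = a)); congruence.
    + intros x y [E|E].
      * injection E as -> ->. destruct (dec (x = x)); congruence.
      * destruct (dec (x = a)) as [->|]; [|auto].
        apply in_combine_l in E. contradiction.
Qed.

End FinitePredicates.

(** * Finitely supported sums *)

Section Sums.

Context {V : Type}.
Open Scope Z_scope.

Definition lsum (f : V -> Z) (l : list V) : Z := fold_right (fun v a => f v + a) 0 l.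

Lemma lsum_permutation f l m : Permutation l m -> lsum f l = lsum f m.
Proof. induction 1; simpl; lia. Qed.

Lemma lsum_filter_nonzero f l :
  lsum f l = lsum f (filter (fun v => negb (f v =? 0)) l).
Proof.
  induction l as [|a l IH]; simpl; auto.
  destruct (Z.eqb_spec (f a) 0); simpl; lia.
Qed.

(** Without their zero terms both lists enumerate the support. A finitely supported sum is thus
    independent of the list used. *)
Lemma lsum_support f l m : NoDup l -> NoDup m ->
  (forall v, f v <> 0 -> In v l) -> (forall v, f v <> 0 -> In v m) -> lsum f l = lsum f m.
Proof.
  intros Hl Hm H1 H2. rewrite (lsum_filter_nonzero f l), (lsum_filter_nonzero f m).
  apply lsum_permutation, NoDup_Permutation; auto using NoDup_filter.
  intros x. rewrite !filter_In. destruct (Z.eqb_spec (f x) 0); simpl; split; intros [? ?]; solve [discriminate|auto].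
Qed.

Lemma lsum_map (f : V -> Z) (g : V -> V) l : lsum f (map g l) = lsum (fun v => f (g v)) l.
Proof. induction l; simpl; lia. Qed.

Lemma lsum_ext f g l : (forall v, f v = g v) -> lsum f l = lsum g l.
Proof. intros H. induction l; simpl; rewrite ?H; lia. Qed.

Lemma lsum_scale f k l : lsum (fun v => k * f v) l = k * lsum f l.
Proof. induction l; simpl; lia. Qed.

Lemma lsum_add f g l : lsum (fun v => f v + g v) l = lsum f l + lsum g l.
Proof. induction l; simpl; lia. Qed.

Lemma lsum_nonneg f l : (forall v, 0 <= f v) -> 0 <= lsum f l.
Proof. intros H. induction l as [|a l IH]; simpl; [lia|]. specialize (H a). lia. Qed.

Lemma lsum_pos f l v : (forall v, 0 <= f v) -> In v l -> 0 < f v -> 0 < lsum f l.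
Proof.
  intros H. induction l as [|a l IH]; simpl; [tauto|].
  intros [->|Hv] Hp.
  - pose proof (lsum_nonneg f l H). lia.
  - specialize (IH Hv Hp). specialize (H a). lia.
Qed.

End Sums.

(** * Connectedness and balls *)

Section Graph.

Context {V : Type} (arc : V -> V -> Prop).
Notation adj := (adj arc).
Notation rt := (clos_refl_trans V).

Lemma adj_sym x y : adj x y -> adj y x.
Proof. intros [H|H]; [right|left]; auto. Qed.

Lemma rt_sym (R : V -> V -> Prop) x y :
  (forall a b, R a b -> R b a) -> rt R x y -> rt R y x.
Proof.
  intros HR. induction 1; [apply rt_step; auto|apply rt_refl|eapply rt_trans; eauto].
Qed.

Lemma rt_mono (R Q : V -> V -> Prop) x y :
  (forall a b, R a b -> Q a b) -> rt R x y -> rt Q x y.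
Proof.
  intros HR. induction 1; [apply rt_step; auto|apply rt_refl|eapply rt_trans; eauto].
Qed.

Lemma rt_invariant (R : V -> V -> Prop) (P : V -> Prop) x y :
  (forall a b, P a -> R a b -> P b) -> rt R x y -> P x -> P y.
Proof. intros HP. induction 1; eauto. Qed.

Lemma connected_invariant (P : V -> Prop) : connected arc ->
  (forall a b, P a -> adj a b -> P b) -> forall a b, P a -> P b.
Proof. intros Hc HP a b. eapply rt_invariant; [exact HP|apply Hc]. Qed.

Lemma adj_in_sym A x y : adj_in arc A x y -> adj_in arc A y x.
Proof. intros [H1 [H2 H3]]. repeat split; auto using adj_sym. Qed.

Lemma induced_connected_from A x0 :
  (forall x, A x -> rt (adj_in arc A) x0 x) -> induced_connected arc A.
Proof.
  intros H x y Hx Hy. apply rt_trans with x0; auto.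
  apply rt_sym; auto. apply adj_in_sym.
Qed.

Lemma induced_connected_union A B u :
  induced_connected arc A -> induced_connected arc B -> A u -> B u ->
  induced_connected arc (fun x => A x \/ B x).
Proof.
  intros HA HB Au Bu. apply induced_connected_from with u.
  intros x [Hx|Hx].
  - apply rt_mono with (2 := HA u x Au Hx). intros a b [H1 [H2 H3]]. repeat split; auto.
  - apply rt_mono with (2 := HB u x Bu Hx). intros a b [H1 [H2 H3]]. repeat split; auto.
Qed.

Lemma induced_connected_eq a : induced_connected arc (fun x => x = a).
Proof. intros x y -> ->. apply rt_refl. Qed.

Lemma induced_connected_add A u z : induced_connected arc A -> A u -> adj u z ->
  induced_connected arc (fun x => A x \/ x = z).
Proof.
  intros HA Au Huz. apply induced_connected_from with u.
  assert (H : forall x, A x -> rt (adj_in arc (fun x => A x \/ x = z)) u x).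
  { intros x Hx. apply rt_mono with (2 := HA u x Au Hx).
    intros a b [H1 [H2 H3]]. repeat split; auto. }
  intros x [Hx| ->]; auto. apply rt_step. repeat split; auto.
Qed.

Fixpoint ball (n : nat) (x y : V) : Prop :=
  match n with
  | 0 => y = x
  | S n => ball n x y \/ exists z, ball n x z /\ adj z y
  end.

Lemma ball_center n x : ball n x x.
Proof. induction n; simpl; auto. Qed.

Lemma ball_mono n m x y : n <= m -> ball n x y -> ball m x y.
Proof. induction 1; simpl; auto. Qed.

Lemma ball_cons n x y z : adj x y -> ball n y z -> ball (S n) x z.
Proof.
  intros Hxy. revert z. induction n as [|n IH]; intros z Hz.
  - simpl in Hz. subst z. right. exists x. split; [apply ball_center|auto].
  - destruct Hz as [Hz|[t [Ht Hz]]].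
    + left. auto.
    + right. exists t. auto.
Qed.

Lemma ball_sym n x y : ball n x y -> ball n y x.
Proof.
  revert y. induction n as [|n IH]; intros y H.
  - now symmetry.
  - destruct H as [H|[z [H1 H2]]]; [left; auto|].
    apply ball_cons with z; auto using adj_sym.
Qed.

Lemma ball_add n m x y z : ball n x y -> ball m y z -> ball (n + m) x z.
Proof.
  revert z. induction m as [|m IH]; intros z H1 H2.
  - simpl in H2. subst z. now rewrite Nat.add_0_r.
  - rewrite Nat.add_succ_r. destruct H2 as [H2|[t [H2 H3]]]; [left; auto|right; eauto].
Qed.

Lemma finite_adj x : locally_finite arc -> finite_pred (adj x).
Proof. intros H. destruct (H x). now apply finite_or. Qed.

Lemma finite_ball n x : locally_finite arc -> finite_pred (ball n x).
Proof.
  intros Hlf. induction n as [|n IH]; simpl.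
  - apply finite_eq.
  - apply finite_or; auto. apply finite_bind; auto. intros a _. now apply finite_adj.
Qed.

Lemma ball_induced_connected n x : induced_connected arc (ball n x).
Proof.
  apply induced_connected_from with x.
  assert (H : forall k y, k <= n -> ball k x y -> rt (adj_in arc (ball n x)) x y).
  { induction k as [|k IH]; intros y Hk Hy.
    - simpl in Hy. subst. apply rt_refl.
    - destruct Hy as [Hy|[z [Hz Hy]]]; [apply IH; auto; lia|].
      apply rt_trans with z; [apply IH; auto; lia|].
      apply rt_step. split; [|split]; auto.
      + apply ball_mono with k; auto; lia.
      + apply ball_mono with (S k); auto. right. eauto. }
  intros y. now apply H.
Qed.

Lemma ball_exhausts x y : connected arc -> exists n, ball n x y.
Proof.
  intros Hc. apply (connected_invariant (fun y => exists n, ball n x y) Hc) with x.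
  - intros a b [n Hn] Hab. exists (S n). right. eauto.
  - exists 0. reflexivity.
Qed.

Lemma finite_in_ball (A : V -> Prop) x : connected arc -> finite_pred A ->
  exists n, forall y, A y -> ball n x y.
Proof.
  intros Hc [l Hl].
  assert (H : exists n, forall y, In y l -> ball n x y).
  { clear Hl. induction l as [|a l [n IH]].
    - exists 0. intros y [].
    - destruct (ball_exhausts x a Hc) as [m Hm]. exists (Nat.max n m).
      intros y [->|Hy].
      + apply ball_mono with m; auto; lia.
      + apply ball_mono with n; auto; lia. }
  destruct H as [n Hn]. eauto.
Qed.

(** A ball is connected, so a set with no cut edge inside it contains all or none of it. *)
Lemma ball_same_side n x (X : V -> Prop) :
  (forall y z, ball n x y -> ball n x z -> adj y z -> X y -> X z) ->
  forall y z, ball n x y -> ball n x z -> X y -> X z.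
Proof.
  intros HX y z Hy Hz Xy.
  apply (rt_invariant (adj_in arc (ball n x)) X y z); auto.
  - intros a b Xa [H1 [H2 H3]]. eauto.
  - now apply ball_induced_connected.
Qed.

Lemma automorphism_inverse g : automorphism arc g ->
  exists h, automorphism arc h /\ (forall x, h (g x) = x) /\ (forall y, g (h y) = y).
Proof.
  intros [[h [H1 H2]] Hg]. exists h. split; [|auto]. split.
  - exists g. auto.
  - intros x y. rewrite (Hg (h x) (h y)), !H2. tauto.
Qed.

Lemma automorphism_compose g k : automorphism arc g -> automorphism arc k ->
  automorphism arc (fun x => k (g x)).
Proof.
  intros [[h [H1 H2]] Hg] [[h' [H1' H2']] Hk]. split.
  - exists (fun x => h (h' x)). split; intros; congruence.
  - intros x y. rewrite (Hg x y), (Hk (g x) (g y)). tauto.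
Qed.

Lemma automorphism_id : automorphism arc (fun x => x).
Proof. split; [exists (fun x => x); auto|tauto]. Qed.

Lemma automorphism_arc g x y : automorphism arc g -> (arc (g x) (g y) <-> arc x y).
Proof. intros [_ Hg]. symmetry. apply Hg. Qed.

Lemma automorphism_adj g x y : automorphism arc g -> (adj (g x) (g y) <-> adj x y).
Proof. intros [_ Hg]. unfold Defs.adj. now rewrite <- !Hg. Qed.

Lemma automorphism_injective g x y : automorphism arc g -> g x = g y -> x = y.
Proof. intros [[h [H _]] _] E. rewrite <- (H x), <- (H y). now f_equal. Qed.

Lemma automorphism_ball g n x y : automorphism arc g -> (ball n (g x) (g y) <-> ball n x y).
Proof.
  intros Hg. revert y. induction n as [|n IH]; intros y; simpl.
  - split; [apply automorphism_injective; auto|now intros ->].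
  - rewrite IH. split; intros [H|[z [H1 H2]]]; auto; right.
    + destruct (automorphism_inverse g Hg) as [h [_ [_ Hh]]].
      exists (h z). rewrite <- IH, Hh. split; auto.
      rewrite <- (automorphism_adj g), Hh; auto.
    + exists (g z). now rewrite IH, automorphism_adj.
Qed.

End Graph.

Notation vertex_transitive arc :=
  (forall x y, exists g, automorphism arc g /\ g x = y).

(** * One-point extensions in connected-homogeneous digraphs *)

Section Homogeneous.

Context {V : Type} (arc : V -> V -> Prop).
Hypothesis Hdig : is_digraph arc.
Hypothesis Hch : connected_homogeneous arc.
Notation adj := (adj arc).

Lemma homogeneous_vertex_transitive : vertex_transitive arc.
Proof.
  intros x y.
  destruct (Hch (fun v => v = x) (fun v => v = y) (fun _ => y)) as [g [Hg Hgx]];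
    auto using finite_eq, induced_connected_eq.
  - repeat split.
    + intros; congruence.
    + intros z ->. eauto.
    + intros K. subst. exfalso. eapply (proj1 Hdig); eauto.
    + intros K. subst. exfalso. eapply (proj1 Hdig); eauto.
  - eauto.
Qed.

(** The identity on [S] together with [z] going to [z'] is an isomorphism of connected induced
    subdigraphs, because [S] cannot tell [z] from [z']. This is the working form of homogeneity in
    most of what follows. *)
Lemma homogeneous_extend_one S u z z' :
  finite_pred S -> induced_connected arc S -> S u -> adj u z -> adj u z' ->
  ~ S z -> ~ S z' ->
  (forall s, S s -> (arc s z <-> arc s z')) -> (forall s, S s -> (arc z s <-> arc z' s)) ->
  exists g, automorphism arc g /\ (forall s, S s -> g s = s) /\ g z = z'.
Proof.
  intros Hf Hc Su Hz Hz' Sz Sz' H1 H2.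
  assert (nz : forall s, S s -> s <> z) by (intros s Hs ->; auto).
  destruct (Hch (fun v => S v \/ v = z) (fun v => S v \/ v = z')
             (fun v => if dec (v = z) then z' else v)) as [g [Hg Hgs]].
  - apply finite_or; auto using finite_eq.
  - apply finite_or; auto using finite_eq.
  - now apply induced_connected_add with u.
  - now apply induced_connected_add with u.
  - repeat split.
    + intros x Hx. destruct (dec (x = z)); intuition.
    + intros x y Hx Hy E. destruct (dec (x = z)), (dec (y = z)); subst; intuition; subst; contradiction.
    + intros y [Hy| ->].
      * exists y. split; auto. destruct (dec (y = z)); auto. exfalso. now apply (nz y).
      * exists z. split; auto. destruct (dec (z = z)); congruence.
    + destruct (dec (x = z)), (dec (y = z)); subst; auto.
      * intros K. now apply (proj1 Hdig) in K.
      * apply H2. intuition.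
      * apply H1. intuition.
    + destruct (dec (x = z)), (dec (y = z)); subst; auto.
      * intros K. now apply (proj1 Hdig) in K.
      * apply H2. intuition.
      * apply H1. intuition.
  - exists g. split; auto. split.
    + intros s Hs. rewrite Hgs; auto. destruct (dec (s = z)); auto. exfalso. now apply (nz s).
    + rewrite Hgs; auto. destruct (dec (z = z)); congruence.
Qed.

(** Vertices are placed one at a time: the first by vertex-transitivity, the next by a one-point
    extension fixing what is already in place. The next two lemmas continue this way; their
    non-adjacency hypotheses make the three-vertex patterns isomorphic. *)
Lemma homogeneous_arc_transitive x y x' y' : arc x y -> arc x' y' ->
  exists g, automorphism arc g /\ g x = x' /\ g y = y'.
Proof.
  intros Hxy Hxy'. destruct (homogeneous_vertex_transitive x x') as [g [Hg Hgx]].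
  assert (Hgxy : arc x' (g y)) by (rewrite <- Hgx, automorphism_arc; auto).
  destruct (homogeneous_extend_one (fun v => v = x') x' (g y) y') as [k [Hk [Hks Hkz]]];
    auto using finite_eq, induced_connected_eq; try (now left).
  - intros E. rewrite E in Hgxy. now apply (proj1 Hdig) in Hgxy.
  - intros ->. now apply (proj1 Hdig) in Hxy'.
  - intros s ->. tauto.
  - intros s ->. split; intros K; exfalso; eapply (proj2 Hdig); eauto.
  - exists (fun v => k (g v)). split; [now apply automorphism_compose|].
    split; auto. rewrite Hgx. auto.
Qed.

Lemma homogeneous_two_arc_transitive x y z x' y' z' :
  arc x y -> arc y z -> ~ adj x z -> arc x' y' -> arc y' z' -> ~ adj x' z' ->
  exists g, automorphism arc g /\ g x = x' /\ g y = y' /\ g z = z'.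
Proof.
  intros Hxy Hyz Nxz Hxy' Hyz' Nxz'.
  destruct (homogeneous_arc_transitive x y x' y') as [g [Hg [Hgx Hgy]]]; auto.
  assert (Hgyz : arc y' (g z)) by (rewrite <- Hgy, automorphism_arc; auto).
  assert (Ngxz : ~ adj x' (g z)) by (rewrite <- Hgx, automorphism_adj; auto).
  destruct (homogeneous_extend_one (fun v => v = x' \/ v = y') y' (g z) z')
    as [k [Hk [Hks Hkz]]]; auto; try (now left).
  - apply finite_or; apply finite_eq.
  - apply induced_connected_add with x'; auto using induced_connected_eq. now left.
  - intros [E|E]; rewrite E in Hgyz.
    + now apply (proj2 Hdig) in Hxy'.
    + now apply (proj1 Hdig) in Hgyz.
  - intros [E|E]; subst z'.
    + now apply (proj2 Hdig) in Hxy'.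
    + now apply (proj1 Hdig) in Hyz'.
  - intros s [->| ->]; [|tauto].
    split; intros K; exfalso; [apply Ngxz|apply Nxz']; now left.
  - intros s [->| ->].
    + split; intros K; exfalso; [apply Ngxz|apply Nxz']; now right.
    + split; intros K; exfalso; eapply (proj2 Hdig); eauto.
  - exists (fun v => k (g v)). split; [now apply automorphism_compose|].
    repeat split; auto.
    + rewrite Hgx. auto.
    + rewrite Hgy. auto.
Qed.

Lemma homogeneous_siblings_transitive u x y u' x' y' :
  arc u x -> arc u y -> x <> y -> ~ adj x y ->
  arc u' x' -> arc u' y' -> x' <> y' -> ~ adj x' y' ->
  exists g, automorphism arc g /\ g u = u' /\ g x = x' /\ g y = y'.
Proof.
  intros Hx Hy Nxy Axy Hx' Hy' Nxy' Axy'.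
  destruct (homogeneous_arc_transitive u x u' x') as [g [Hg [Hgu Hgx]]]; auto.
  assert (Hgy : arc u' (g y)) by (rewrite <- Hgu, automorphism_arc; auto).
  assert (Agxy : ~ adj x' (g y)) by (rewrite <- Hgx, automorphism_adj; auto).
  destruct (homogeneous_extend_one (fun v => v = u' \/ v = x') u' (g y) y')
    as [k [Hk [Hks Hkz]]]; auto; try (now left).
  - apply finite_or; apply finite_eq.
  - apply induced_connected_add with u'; auto using induced_connected_eq. now left.
  - intros [E|E].
    + rewrite E in Hgy. now apply (proj1 Hdig) in Hgy.
    + rewrite <- Hgx in E. apply automorphism_injective with (1 := Hg) in E. auto.
  - intros [E|E]; subst y'; auto. now apply (proj1 Hdig) in Hy'.
  - intros s [->| ->]; [tauto|].
    split; intros K; exfalso; [apply Agxy|apply Axy']; now left.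
  - intros s [->| ->].
    + split; intros K; exfalso; eapply (proj2 Hdig); eauto.
    + split; intros K; exfalso; [apply Agxy|apply Axy']; now right.
  - exists (fun v => k (g v)). split; [now apply automorphism_compose|].
    repeat split; auto.
    + rewrite Hgu. auto.
    + rewrite Hgx. auto.
Qed.

End Homogeneous.

(** * Finite cuts and rays *)

(** Both ends of each cut edge are included, so a set and its complement have the same boundary. *)
Definition boundary {V : Type} (arc : V -> V -> Prop) (X : V -> Prop) (x : V) : Prop :=
  exists y, adj arc x y /\ ((X x /\ ~ X y) \/ (~ X x /\ X y)).

Definition eventually_in {V : Type} (r : nat -> V) (X : V -> Prop) : Prop :=
  exists N, forall n, N <= n -> X (r n).

(** * Paths as lists *)

Fixpoint chain {V : Type} (R : V -> V -> Prop) (l : list V) : Prop :=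
  match l with
  | x :: (y :: _) as t => R x y /\ chain R t
  | _ => True
  end.

Section Chains.

Context {V : Type} (R : V -> V -> Prop).

Lemma chain_suffix q l : chain R (q ++ l) -> chain R l.
Proof.
  induction q as [|a q IH]; simpl; auto. intros H. apply IH.
  destruct (q ++ l); simpl; auto. apply H.
Qed.

Lemma chain_app q x a l : chain R (q ++ [x]) -> R x a -> chain R (a :: l) ->
  chain R ((q ++ [x]) ++ a :: l).
Proof.
  intros Hq Hxa Hl. induction q as [|b q IH].
  - simpl. auto.
  - destruct q as [|c q].
    + simpl in *. intuition.
    + split; [apply Hq|]. apply IH. apply Hq.
Qed.

Lemma chain_nth l d i : chain R l -> S i < length l -> R (nth i l d) (nth (S i) l d).
Proof.
  revert i. induction l as [|a l IH]; simpl; [lia|]. intros i Hc Hi.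
  destruct l as [|b l]; [simpl in Hi; lia|].
  destruct i; [apply Hc|]. apply (IH i); [apply Hc|lia].
Qed.

(** Loop erasure: if the next vertex already lies on the path, everything after its earlier visit is
    dropped. The list runs backwards, from [y] to [x], so that extending the path is a [cons]. *)
Lemma rt_simple_path (Q : V -> Prop) x y : Q x ->
  clos_refl_trans V (fun a b => Q a /\ Q b /\ R a b) x y ->
  (forall a b, R a b -> R b a) ->
  exists q, NoDup q /\ chain R q /\ (forall v, In v q -> Q v) /\
    (exists q', q = y :: q') /\ (exists q', q = q' ++ [x]).
Proof.
  intros Qx H Hsym. apply clos_rt_rtn1 in H. induction H as [|y z [Qy [Qz Hyz]] H IH].
  - exists [x]. repeat split; simpl; auto.
    + repeat constructor. auto.
    + intros v [->|[]]. auto.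
    + now exists [].
    + now exists [].
  - destruct IH as [q [Hn [Hc [HQ [[q' E1] [q'' E2]]]]]].
    destruct (dec (In z q)) as [Hz|Hz].
    + apply in_split in Hz. destruct Hz as [l1 [l2 E]].
      exists (z :: l2). rewrite E in Hn, Hc, HQ. repeat split.
      * clear - Hn. induction l1; simpl in Hn; auto. inversion Hn; auto.
      * now apply chain_suffix in Hc.
      * intros v Hv. apply HQ. apply in_or_app. auto.
      * now exists l2.
      * rewrite E in E2. destruct (exists_last (l := z :: l2)) as [t [b Et]]; [discriminate|].
        rewrite Et in E2. rewrite app_assoc in E2. apply app_inj_tail in E2.
        destruct E2 as [_ ->]. eauto.
    + exists (z :: q). repeat split.
      * now constructor.
      * rewrite E1 in *. split; auto.
      * intros v [->|Hv]; auto.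
      * now exists q.
      * exists (z :: q''). now rewrite E2.
Qed.

End Chains.

(** * A ray zigzagging between two rays *)

Section Zigzag.

Context {V : Type} (arc : V -> V -> Prop).
Notation adj := (adj arc).

(** No finite set separates [a] from [b]. Since [F] may include initial segments, for rays the
    joined vertices can be forced arbitrarily far out. *)
Definition linked (a b : nat -> V) : Prop := forall F : list V, exists j m,
  ~ In (a j) F /\ clos_refl_trans V (adj_in arc (fun v => ~ In v F)) (a j) (b m) /\ ~ In (b m) F.

(** A path with its newest vertex first. Its head lies on [a] and the remainder of [a] avoids it, so
    it can be continued along [a]. *)
Definition good_path (a : nat -> V) (l : list V) : Prop :=
  NoDup l /\ chain adj l /\
  exists i, (exists l0, l = a i :: l0) /\ forall k, i < k -> ~ In (a k) l.

(** Follow [a] beyond the head, cross over to [b] outside the path, erase loops, and cut off the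
    result at its vertex of largest index on [b]. *)
Lemma good_path_step a b l : ray arc a -> ray arc b -> linked a b -> good_path a l ->
  exists q, q <> [] /\ good_path b (q ++ l).
Proof.
  intros [Ia Aa] [Ib Ab] Hlink [Hn [Hc [i [[l0 El] Hi]]]].
  destruct (injective_avoids_list b l Ib) as [N HN].
  (* The forbidden set is the path together with initial segments of both rays, which forces [i < j]
     and [N <= m]. *)
  destruct (Hlink (l ++ map a (seq 0 (S i)) ++ map b (seq 0 N))) as [j [m [Hj [Hjm Hm]]]].
  rewrite !in_app_iff in Hj, Hm.
  assert (Hij : i < j).
  { apply Nat.nle_gt. intros K. apply Hj. right. left. apply in_map, in_seq. lia. }
  assert (HNm : N <= m).
  { apply Nat.nlt_ge. intros K. apply Hm. right. right. apply in_map, in_seq. lia. }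
  set (Q := fun v => ~ In v l).
  assert (P1 : clos_refl_trans V (fun x y => Q x /\ Q y /\ adj x y) (a (S i)) (a j)).
  { clear - Hij Hi Aa. induction j as [|j IH]; [lia|].
    destruct (Nat.eq_dec i j) as [->|Hne]; [apply rt_refl|].
    apply rt_trans with (a j); [apply IH; lia|]. apply rt_step.
    repeat split; auto; apply Hi; lia. }
  assert (P2 : clos_refl_trans V (fun x y => Q x /\ Q y /\ adj x y) (a j) (b m)).
  { apply rt_mono with (2 := Hjm). intros x y [H1 [H2 H3]].
    rewrite !in_app_iff in H1, H2. unfold Q. tauto. }
  destruct (rt_simple_path adj Q (a (S i)) (b m)) as [q [Qn [Qc [QQ [[q1 E1] [q2 E2]]]]]].
  - apply Hi. lia.
  - eapply rt_trans; eauto.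
  - intros; now apply adj_sym.
  (* The largest index [k] is at least [m], hence at least [N], so [b k] lies on the new part [q]
     and not on [l]. *)
  - destruct (max_index_in_list b (q ++ l) m Ib) as [k [Hk [Hkin Hkmax]]].
    { rewrite E1. now left. }
    apply in_app_or in Hkin. destruct Hkin as [Hkin|Hkin]; [|exfalso; apply (HN k); auto; lia].
    apply in_split in Hkin. destruct Hkin as [t1 [t2 Et]].
    assert (Hnd : NoDup (q ++ l)) by (apply NoDup_app; auto; intros v Hv; now apply QQ).
    assert (Hch : chain adj (q ++ l)).
    { rewrite E2, El. apply chain_app; [congruence| |congruence].
      apply adj_sym. apply Aa. }
    rewrite Et, <- app_assoc in Hnd, Hch, Hkmax.
    exists (b k :: t2). split; [discriminate|]. split; [|split].
    + clear - Hnd. induction t1; simpl in Hnd; auto. inversion Hnd; auto.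
    + now apply chain_suffix in Hch.
    + exists k. split; [simpl; eauto|]. intros n Hkn Hin. apply (Hkmax n Hkn).
      apply in_or_app. now right.
Qed.

(** Extending alternately towards [b] and towards [a] yields nested paths whose union is a ray
    meeting both infinitely often. *)
Lemma linked_rays_equiv a b : ray arc a -> ray arc b -> linked a b -> linked b a ->
  ray_equiv arc a b.
Proof.
  intros Ra Rb Lab Lba.
  (* [c n] is the ray carrying the head of stage [n]. *)
  set (c := fun n => if Nat.even n then a else b).
  set (next := fun n l => epsilon (inhabits []) (fun l' =>
        exists q, q <> [] /\ l' = q ++ l /\ good_path (c (S n)) l')).
  set (st := fix st n := match n with 0 => [a 0] | S n => next n (st n) end).
  assert (Hnext : forall n, good_path (c n) (st n) -> exists q,
            q <> [] /\ st (S n) = q ++ st n /\ good_path (c (S n)) (st (S n))).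
  { intros n Hn. change (st (S n)) with (next n (st n)). unfold next. apply epsilon_spec.
    assert (H : exists q, q <> [] /\ good_path (c (S n)) (q ++ st n)).
    { apply good_path_step with (a := c n); auto; unfold c;
        rewrite ?Nat.even_succ, <- ?Nat.negb_even; destruct (Nat.even n); auto. }
    destruct H as [q [Hq1 Hq2]]. eauto. }
  assert (Hst : forall n, good_path (c n) (st n)).
  { induction n as [|n IH].
    - split; [repeat constructor; auto|]. split; [simpl; auto|].
      exists 0. split; [now exists []|]. intros k Hk [E|[]].
      apply (proj1 Ra) in E. lia.
    - destruct (Hnext n IH) as [q Hq]. apply Hq. }
  assert (Hlen : forall n, n < length (st n)).
  { induction n as [|n IH]; [simpl; lia|].
    destruct (Hnext n (Hst n)) as [q [Hq [E _]]]. rewrite E, length_app.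
    destruct q; [congruence|simpl; lia]. }
  (* Stages grow at the front only, so in reversed order an existing position never changes; stage
     [n] is already longer than [n]. *)
  set (s := fun n => nth n (rev (st n)) (a 0)).
  assert (Hmono : forall n m j, n <= m -> j < length (st n) ->
            j < length (st m) /\ nth j (rev (st m)) (a 0) = nth j (rev (st n)) (a 0)).
  { intros n m j Hnm Hj. induction Hnm as [|m Hnm [IH1 IH2]]; auto.
    destruct (Hnext m (Hst m)) as [q [_ [E _]]]. rewrite E, length_app, rev_app_distr.
    split; [lia|]. rewrite app_nth1; auto. now rewrite length_rev. }
  assert (Hs : forall n j, j < length (st n) -> s j = nth j (rev (st n)) (a 0)).
  { intros n j Hj. unfold s. transitivity (nth j (rev (st (Nat.max n j))) (a 0)).
    - symmetry. apply Hmono; [lia|apply Hlen].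
    - apply Hmono; [lia|auto]. }
  assert (Hmeet : forall n, exists k, s (length (st n) - 1) = c n k).
  { intros n. rewrite (Hs n) by (specialize (Hlen n); lia).
    destruct (Hst n) as [_ [_ [i [[l0 E] _]]]]. exists i. rewrite rev_nth by (rewrite E; simpl; lia).
    rewrite E. simpl. replace (length l0 - _) with 0 by lia. reflexivity. }
  exists s. split; [split|split].
  - intros m n E.
    assert (Hm : m < length (st (Nat.max m n))) by (specialize (Hlen (Nat.max m n)); lia).
    assert (Hn : n < length (st (Nat.max m n))) by (specialize (Hlen (Nat.max m n)); lia).
    rewrite (Hs _ _ Hm), (Hs _ _ Hn) in E.
    destruct (Hst (Nat.max m n)) as [Hnd _]. apply NoDup_rev in Hnd.
    rewrite (NoDup_nth _ (a 0)) in Hnd. apply Hnd; rewrite ?length_rev; auto.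
  - intros n. pose proof (Hlen (S n)) as L.
    rewrite (Hs (S n) n), (Hs (S n) (S n)) by lia. rewrite !rev_nth by lia.
    destruct (Hst (S n)) as [_ [Hc _]]. apply adj_sym.
    replace (length (st (S n)) - S n) with (S (length (st (S n)) - S (S n))) by lia.
    apply chain_nth; auto. lia.
  - intros N. destruct (Hmeet (2 * N)) as [k Hk].
    exists (length (st (2 * N)) - 1), k. split; [specialize (Hlen (2 * N)); lia|].
    rewrite Hk. unfold c. now rewrite Nat.even_mul.
  - intros N. destruct (Hmeet (S (2 * N))) as [k Hk].
    exists (length (st (S (2 * N))) - 1), k. split; [specialize (Hlen (S (2 * N))); lia|].
    rewrite Hk. unfold c. rewrite Nat.even_succ, <- Nat.negb_even. now rewrite Nat.even_mul.
Qed.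

End Zigzag.

(** * Finite cuts and the rays they separate *)

Section Cuts.

Context {V : Type} (arc : V -> V -> Prop).
Hypothesis Hlf : locally_finite arc.
Notation adj := (adj arc).
Notation boundary := (boundary arc).

(** Beyond some index the ray avoids the finite boundary, and from there on it cannot change
    sides. *)
Lemma ray_same_side r X : ray arc r -> finite_pred (boundary X) ->
  eventually_in r X \/ eventually_in r (fun v => ~ X v).
Proof.
  intros [Ir Ar] [l Hl]. destruct (injective_avoids_list r l Ir) as [N HN].
  destruct (classic (X (r N))) as [H|H]; [left|right]; exists N; intros n Hn.
  - induction Hn as [|n Hn IH]; auto. apply NNPP. intros K. apply (HN n Hn), Hl.
    exists (r (S n)). split; auto.
  - induction Hn as [|n Hn IH]; auto. intros K. apply (HN n Hn), Hl.
    exists (r (S n)). split; auto.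
Qed.

(** If no such cut exists, then for every finite [F] the component of a tail of [a] outside [F],
    whose boundary lies in [F] and its neighbours, is met by [b] arbitrarily late. The rays are then
    linked, hence equivalent. *)
Lemma separating_cut a b : ray arc a -> ray arc b -> ~ ray_equiv arc a b ->
  exists E, finite_pred (boundary E) /\ eventually_in a E /\ eventually_in b (fun v => ~ E v).
Proof.
  intros Ra Rb Hab. apply NNPP. intros Hno. apply Hab.
  assert (Hlink : linked arc a b).
  { intros F. destruct (injective_avoids_list a F (proj1 Ra)) as [N HN].
    destruct (injective_avoids_list b F (proj1 Rb)) as [M HM].
    set (E := fun v => clos_refl_trans V (adj_in arc (fun v => ~ In v F)) (a N) v).
    assert (HE : forall v, E v -> ~ In v F).
    { intros v Hv. apply (rt_invariant (adj_in arc (fun v => ~ In v F)) (fun v => ~ In v F) (a N) v); auto.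
      intros x y _ [_ [H _]]. exact H. }
    assert (HEb : finite_pred (boundary E)).
    { apply finite_sub with (B := fun v => In v F \/ exists f, In f F /\ adj f v).
      - intros x [y [Hxy [[H1 H2]|[H1 H2]]]].
        + right. exists y. split; [|now apply adj_sym]. apply NNPP. intros K. apply H2.
          apply rt_trans with x; auto. apply rt_step. repeat split; auto.
        + left. apply NNPP. intros K. apply H1.
          apply rt_trans with y; auto. apply rt_step. repeat split; auto using adj_sym.
      - apply finite_or; [now exists F|]. apply finite_bind; [now exists F|].
        intros f _. now apply finite_adj. }
    assert (HEa : eventually_in a E).
    { exists N. intros n Hn. induction Hn as [|n Hn IH]; [apply rt_refl|].
      apply rt_trans with (a n); auto. apply rt_step. repeat split; auto. apply Ra. }
    destruct (classic (exists m, M <= m /\ E (b m))) as [[m [Hm Em]]|Hm].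
    - exists N, m. repeat split; auto.
    - exfalso. apply Hno. exists E. repeat split; auto. exists M. intros n Hn K.
      apply Hm. eauto. }
  apply linked_rays_equiv; auto.
  intros F. destruct (Hlink F) as [j [m [H1 [H2 H3]]]]. exists m, j. repeat split; auto.
  apply rt_sym; auto. apply adj_in_sym.
Qed.

Lemma meets_inf_same_side s r X : ray arc s -> ray arc r -> meets_inf s r ->
  eventually_in s X -> eventually_in r (fun v => ~ X v) -> False.
Proof.
  intros Rs Rr Hm [N HN] [M HM].
  destruct (injective_avoids_list s (map r (seq 0 M)) (proj1 Rs)) as [K HK].
  destruct (Hm (N + K)) as [n [m [Hn E]]].
  apply (HM m); [|rewrite <- E; apply HN; lia].
  apply Nat.nlt_ge. intros Hlt. apply (HK n); [lia|]. rewrite E. apply in_map, in_seq. lia.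
Qed.

Lemma boundary_compl X v : boundary (fun v => ~ X v) v -> boundary X v.
Proof. intros [y [Hy H]]. exists y. split; auto. destruct (classic (X v)), (classic (X y)); tauto. Qed.

Lemma boundary_and X Y v : boundary (fun v => X v /\ Y v) v -> boundary X v \/ boundary Y v.
Proof.
  intros [y [Hy H]].
  assert (K : ((X v /\ ~ X y) \/ (~ X v /\ X y)) \/ ((Y v /\ ~ Y y) \/ (~ Y v /\ Y y))).
  { destruct (classic (X v)), (classic (X y)), (classic (Y v)), (classic (Y y)); tauto. }
  destruct K; [left|right]; exists y; auto.
Qed.

Lemma ray_equiv_same_side a b X : ray arc a -> ray arc b -> ray_equiv arc a b ->
  finite_pred (boundary X) -> eventually_in a X -> eventually_in b X.
Proof.
  intros Ra Rb [s [Rs [Ma Mb]]] HX Ha.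
  destruct (ray_same_side b X Rb HX) as [|Hb]; auto. exfalso.
  destruct (ray_same_side s X Rs HX) as [Hs|Hs].
  - now apply (meets_inf_same_side s b X).
  - apply (meets_inf_same_side s a (fun v => ~ X v)); auto.
    destruct Ha as [N HN]. exists N. intros n Hn K. now apply K, HN.
Qed.

End Cuts.

(** * Commensurable sets *)

(** Sets with finite boundary, taken up to this relation, stand in for the ends, so that
    automorphisms act on ends without mention of rays. *)
Definition commens {V : Type} (X Y : V -> Prop) : Prop :=
  finite_pred (fun v => (X v /\ ~ Y v) \/ (~ X v /\ Y v)).

Section Commensurability.

Context {V : Type}.
Implicit Types X Y : V -> Prop.

Lemma commens_sym X Y : commens X Y -> commens Y X.
Proof. apply finite_sub. tauto. Qed.

Lemma commens_trans X Y Z : commens X Y -> commens Y Z -> commens X Z.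
Proof.
  intros H1 H2. apply finite_sub with (2 := finite_or _ _ H1 H2). intros v.
  destruct (classic (Y v)); tauto.
Qed.

Lemma commens_compl X Y : commens X Y -> commens (fun v => ~ X v) (fun v => ~ Y v).
Proof. apply finite_sub. intros v. destruct (classic (X v)), (classic (Y v)); tauto. Qed.

Lemma commens_precomp X Y (g h : V -> V) : (forall x, h (g x) = x) ->
  commens X Y -> commens (fun v => X (g v)) (fun v => Y (g v)).
Proof. intros Hh H. exact (finite_preimage _ g h Hh H). Qed.

Lemma commens_finite_diff X Y : commens X Y -> finite_pred (fun v => X v /\ ~ Y v).
Proof. apply finite_sub. tauto. Qed.

End Commensurability.

(** * The height cocycle of a two-ended vertex-transitive graph *)

Section Separation.

Context {V : Type} (arc : V -> V -> Prop).
Hypothesis Hconn : connected arc.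
Hypothesis Hlf : locally_finite arc.
Notation adj := (adj arc).
Notation boundary := (boundary arc).
Notation ball := (ball arc).

(** Says that [A] is a union of connected components of the complement of [B]. *)
Definition closed_off (A B : V -> Prop) : Prop :=
  (forall v, A v -> ~ B v) /\ (forall a b, A a -> adj a b -> ~ B b -> A b).

(* The vertices outside [ball R x] on the side of the end represented by [X]; a finite component
   of the complement of the ball counts as lying on every side. *)
Definition on_side (R : nat) (X : V -> Prop) (x v : V) : Prop :=
  exists A, commens A X /\ closed_off A (ball R x) /\ A v.

Definition finite_piece (R : nat) (x v : V) : Prop :=
  exists K, finite_pred K /\ closed_off K (ball R x) /\ K v.

Lemma no_proper_closed (S : V -> Prop) a b :
  (forall x y, S x -> adj x y -> S y) -> S a -> ~ S b -> False.
Proof. intros H Ha Hb. apply Hb. now apply (connected_invariant arc S Hconn H a b). Qed.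

(** By connectedness every component of the complement touches the finite set [N] of neighbours of
    the ball, so only finitely many finite components occur. *)
Lemma finite_finite_piece R x : finite_pred (finite_piece R x).
Proof.
  assert (HN : finite_pred (fun v => exists b, ball R x b /\ adj b v)).
  { apply finite_bind; [now apply finite_ball|]. intros; now apply finite_adj. }
  destruct HN as [N HN].
  assert (HK : exists K, finite_pred K /\ closed_off K (ball R x) /\
            forall u, In u N -> finite_piece R x u -> K u).
  { clear HN. induction N as [|u N [K [HK1 [[HK2 HK3] HK4]]]].
    - exists (fun _ => False). repeat split; try tauto. now exists [].
    - destruct (classic (finite_piece R x u)) as [[K' [H1 [[H2 H3] H4]]]|H].
      + exists (fun v => K v \/ K' v). repeat split.
        * now apply finite_or.
        * intros v [H|H]; auto.
        * intros a b [H|H] Hab Hb; eauto.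
        * intros w [->|Hw] Hp; auto.
      + exists K. repeat split; auto. intros w [->|Hw] Hp; [contradiction|auto]. }
  destruct HK as [K [HK1 [[HK2 HK3] HK4]]].
  apply finite_sub with (2 := HK1). intros u [K' [H1 [[H2 H3] H4]]].
  apply NNPP. intros Hu.
  (* Any vertex of [K'] next to the ball lies in [K], so [K'] minus [K] is closed under adjacency,
     yet it misses [x]. *)
  apply (no_proper_closed (fun v => K' v /\ ~ K v) u x).
  - intros a b [Ha1 Ha2] Hab.
    assert (Hb : ~ ball R x b).
    { intros Hb. apply Ha2. apply HK4; [|exists K'; repeat split; auto].
      apply HN. exists b. split; auto using adj_sym. }
    split; [eauto|]. intros Kb. apply Ha2. apply HK3 with b; auto using adj_sym.
  - auto.
  - intros [Hx _]. apply (H2 x Hx), ball_center.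
Qed.

(** * Nesting of sides at two distant vertices *)

Section FarPoints.

Variables (R : nat) (X X0 X1 : V -> Prop) (x v : V).
Hypothesis X_coinf : ~ finite_pred (fun u => ~ X u).
Hypothesis X0_X : commens X0 X.
Hypothesis X1_X : commens X1 X.
Hypothesis X0_bd : forall u, boundary X0 u -> ball R x u.
Hypothesis X1_bd : forall u, boundary X1 u -> ball R v u.
Hypothesis far_ball : forall u, ball R v u -> ~ ball R x u.
Hypothesis far_piece : forall u, ball R v u -> ~ finite_piece R x u.
Hypothesis X0_v : X0 v.

Lemma far_ball_inside u : ball R v u -> X0 u.
Proof.
  intros Hu. apply (ball_same_side arc R v X0) with v; auto using ball_center.
  intros y z Hy Hz Hyz Xy. apply NNPP. intros Xz. apply (far_ball y Hy), X0_bd.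
  exists z. auto.
Qed.

(** If [A] met the ball at [x] it would contain that ball, and with it the boundary of [X0]. The
    graph would then be the union of [X0] and [A], making the complement of [X] finite. So [A]
    avoids this ball; then [A] minus [X0] is closed under adjacency but misses [v], hence is
    empty. *)
Lemma far_side_nested A : commens A X -> closed_off A (ball R v) ->
  forall u, A u -> X0 u /\ ~ ball R x u.
Proof.
  intros AX [A1 A2].
  assert (Hx : forall u, A u -> ~ ball R x u).
  { intros u Au Hu.
    assert (Hball : forall t, ball R x t -> A t).
    { intros t Ht. apply (ball_same_side arc R x A) with u; auto.
      intros y z Hy Hz Hyz Ay. apply (A2 y z); auto. intros K. now apply (far_ball z). }
    apply X_coinf. apply finite_sub with (2 := finite_or _ _
      (commens_finite_diff _ _ X0_X) (commens_finite_diff _ _ AX)).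
    intros c Xc. destruct (classic (X0 c)) as [Hc|Hc]; [now left|]. right. split; auto.
    apply NNPP. intros Ac.
    apply (no_proper_closed (fun t => ~ X0 t /\ ~ A t) c v); auto.
    - intros s t [Hs1 Hs2] Hst.
      assert (Ht : ~ X0 t).
      { intros Ht. apply Hs2, Hball, X0_bd. exists t. auto. }
      split; auto. intros At. apply Hs2. apply (A2 t s); auto using adj_sym.
      intros K. apply Hs1. now apply far_ball_inside.
    - tauto. }
  intros u Au. split; auto. apply NNPP. intros Xu.
  apply (no_proper_closed (fun t => A t /\ ~ X0 t) u v); auto.
  - intros s t [As Xs] Hst.
    assert (Xt : ~ X0 t).
    { intros Ht. apply (Hx s As), X0_bd. exists t. auto. }
    split; auto. apply (A2 s t); auto. intros K. apply Xt. now apply far_ball_inside.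
  - tauto.
Qed.

Lemma side_witness Y (B : V -> Prop) : finite_pred B -> (forall u, boundary Y u -> B u) ->
  commens (fun u => Y u /\ ~ B u) Y /\ closed_off (fun u => Y u /\ ~ B u) B.
Proof.
  intros HB HY. repeat split; try tauto.
  - apply finite_sub with (2 := HB). intros u. destruct (classic (B u)); tauto.
  - destruct H as [Ya Ba]. apply NNPP. intros Yb. apply Ba, HY. exists b. auto.
Qed.

Lemma far_on_side_sub u : on_side R X v u -> on_side R X x u.
Proof.
  intros [A [AX [Ac Au]]].
  destruct (side_witness X0 (ball R x)) as [H1 H2]; auto using finite_ball.
  exists (fun u => X0 u /\ ~ ball R x u). split; [|split]; auto.
  - now apply commens_trans with X0.
  - now apply (far_side_nested A).
Qed.

(** [A] and [X0] are commensurable with complementary sets, so they meet in a finite set, which is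
    still closed off because the boundary of [X0] lies in the ball. *)
Lemma opposite_side_piece u : on_side R (fun u => ~ X u) x u -> X0 u -> finite_piece R x u.
Proof.
  intros [A [AX [[A1 A2] Au]]] Xu.
  exists (fun u => A u /\ X0 u). split; [|split; [split|]]; auto.
  - apply finite_sub with (2 := finite_or _ _
      (commens_finite_diff _ _ X0_X) (commens_finite_diff _ _ AX)).
    intros t [At Xt]. destruct (classic (X t)); tauto.
  - intros t [At _]. auto.
  - intros s t [As Xs] Hst Ht. split; [eauto|]. apply NNPP. intros Xt.
    apply (A1 s As), X0_bd. exists t. auto.
Qed.

(** For the opposite end the inclusion of sides is reversed. If [u] lay in the ball at [v] or in
    [X1], it would lie in [X0], hence in a finite component at [x]; the first case contradicts
    [far_piece], the second connectedness. *)
Lemma far_on_opposite_side_sup u :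
  on_side R (fun u => ~ X u) x u -> on_side R (fun u => ~ X u) v u.
Proof.
  intros Hu.
  destruct (side_witness (fun u => ~ X1 u) (ball R v)) as [H1 H2]; auto using finite_ball.
  { intros t Ht. now apply X1_bd, boundary_compl. }
  exists (fun u => ~ X1 u /\ ~ ball R v u). split; [|split]; auto.
  - apply commens_trans with (fun u => ~ X1 u); auto using commens_compl.
  - assert (Hv : ~ ball R v u).
    { intros K. apply (far_piece u K). apply opposite_side_piece; auto.
      now apply far_ball_inside. }
    split; auto. intros Xu.
    destruct (side_witness X1 (ball R v)) as [H3 H4]; auto using finite_ball.
    pose proof (far_side_nested _ (commens_trans _ _ _ H3 X1_X) H4) as Hn.
    assert (Hp : finite_piece R x u) by (apply opposite_side_piece; auto; now apply Hn).
    (* The [X] side at [v] avoids the ball at [x], and finite components at [x] avoid the ball at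
       [v]; so their intersection is closed under adjacency, yet it misses [v]. *)
    apply (no_proper_closed (fun t => (X1 t /\ ~ ball R v t) /\ finite_piece R x t) u v); auto.
    + intros s t [As [K [K1 [[K2 K3] Ks]]]] Hst.
      assert (Ht : ~ ball R x t).
      { intros Ht. assert (At : X1 t /\ ~ ball R v t).
        { apply (proj2 H4) with s; auto. intros Kt. now apply (far_ball t). }
        now apply (Hn t). }
      assert (Pt : finite_piece R x t).
      { exists K. repeat split; auto. now apply (K3 s t). }
      split; auto. apply (proj2 H4) with s; auto. intros Kt. now apply (far_piece t).
    + intros [_ Hpv]. apply (far_piece v); auto using ball_center.
Qed.

(** This makes the nesting strict, since [v] lies in its own ball and so on no side at [v]. *)
Lemma far_point_on_side : on_side R X x v /\ ~ on_side R (fun u => ~ X u) x v.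
Proof.
  split.
  - destruct (side_witness X0 (ball R x)) as [H1 H2]; auto using finite_ball.
    exists (fun u => X0 u /\ ~ ball R x u). split; [|split]; auto.
    + now apply commens_trans with X0.
    + split; auto. apply far_ball, ball_center.
  - intros H. apply (far_piece v); auto using ball_center. now apply opposite_side_piece.
Qed.

End FarPoints.

(** The two sets differ only inside three finite sets: the difference of [X0] and [X], the finite
    components, and the ball. This is what makes the differences of [w] finitely supported later. *)
Lemma on_side_commens R X X0 x : commens X0 X -> (forall u, boundary X0 u -> ball R x u) ->
  commens (on_side R X x) X.
Proof.
  intros X0_X X0_bd.
  destruct (side_witness X0 (ball R x)) as [H1 H2]; auto using finite_ball.
  pose proof (finite_finite_piece R x) as HF.
  apply finite_sub with (2 := finite_or _ _ X0_X (finite_or _ _ HF (finite_ball arc R x Hlf))).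
  intros v [[[A [AX [[A1 A2] Av]]] Xv]|[Hv Xv]].
  - destruct (classic (X0 v)) as [Hv|Hv]; [left; tauto|]. right. left.
    apply (opposite_side_piece R (fun u => ~ X u) (fun u => ~ X0 u) x); auto.
    + now apply commens_compl.
    + intros u Hu. now apply X0_bd, boundary_compl.
    + exists A. split; [|split; [split|]]; auto.
      apply finite_sub with (2 := AX). intros u. destruct (classic (X u)); tauto.
  - destruct (classic (X0 v)) as [Hv0|Hv0]; [|left; tauto].
    right. right. apply NNPP. intros Hb. apply Hv.
    exists (fun u => X0 u /\ ~ ball R x u). split; [|split]; auto.
    now apply commens_trans with X0.
Qed.

Lemma on_side_commens_sub R X Y x v : commens X Y -> on_side R X x v -> on_side R Y x v.
Proof. intros H [A [HA K]]. exists A. split; auto. now apply commens_trans with X. Qed.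

Lemma boundary_automorphism g X v : automorphism arc g ->
  boundary (fun u => X (g u)) v -> boundary X (g v).
Proof.
  intros Hg [y [Hy H]]. exists (g y). split; auto. now apply automorphism_adj.
Qed.

Lemma on_side_automorphism g R X x v : automorphism arc g ->
  (on_side R X (g x) (g v) <-> on_side R (fun u => X (g u)) x v).
Proof.
  intros Hg. destruct (automorphism_inverse arc g Hg) as [h [Hh [H1 H2]]].
  split; intros [A [AX [[A1 A2] Av]]].
  - exists (fun u => A (g u)). repeat split; auto.
    + now apply commens_precomp with h.
    + intros u Au K. apply (A1 (g u) Au). now apply automorphism_ball.
    + intros a b Aa Hab Hb. apply (A2 (g a)); auto; [now apply automorphism_adj|].
      now rewrite automorphism_ball.
  - exists (fun u => A (h u)). repeat split.
    + apply commens_precomp with (g := h) (h := g) in AX; auto.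
      apply finite_sub with (2 := AX). intros u. now rewrite H2.
    + intros u Au K. apply (A1 (h u) Au). rewrite <- (automorphism_ball arc g), H2; auto.
    + intros a b Aa Hab Hb. apply (A2 (h a)); auto; [now apply automorphism_adj|].
      rewrite <- (automorphism_ball arc g), H2; auto.
    + now rewrite H1.
Qed.

End Separation.

(** * Cuts of two-ended graphs and the height function *)

Section TwoEnded.

Context {V : Type} (arc : V -> V -> Prop).
Hypothesis Hconn : connected arc.
Hypothesis Hlf : locally_finite arc.
Hypothesis Hvt : vertex_transitive arc.
Notation adj := (adj arc).
Notation boundary := (boundary arc).
Notation ball := (ball arc).

Lemma eventually_in_infinite r X : ray arc r -> eventually_in r X -> ~ finite_pred X.
Proof.
  intros [Ir _] [N HN] [l Hl]. destruct (injective_avoids_list r l Ir) as [M HM].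
  apply (HM (N + M)); [lia|]. apply Hl, HN. lia.
Qed.

Lemma eventually_in_disjoint r (X Y : V -> Prop) : eventually_in r X -> eventually_in r Y ->
  (forall v, X v -> Y v -> False) -> False.
Proof. intros [N HN] [M HM] H. apply (H (r (N + M))); [apply HN|apply HM]; lia. Qed.

Lemma eventually_in_sub r (X Y : V -> Prop) :
  (forall v, X v -> Y v) -> eventually_in r X -> eventually_in r Y.
Proof. intros H [N HN]. exists N. auto. Qed.

Lemma ray_automorphism g r : automorphism arc g -> ray arc r -> ray arc (fun n => g (r n)).
Proof.
  intros Hg [H1 H2]. split.
  - intros m n E. apply automorphism_injective with (1 := Hg) in E. auto.
  - intros n. now apply automorphism_adj.
Qed.

(* Moving the cut [E] far into [Y] by an automorphism puts one side of it inside [Y]. *)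
Lemma infinite_cut_contains_ray E a b Y :
  finite_pred (boundary E) -> ray arc a -> ray arc b ->
  eventually_in a E -> eventually_in b (fun v => ~ E v) ->
  finite_pred (boundary Y) -> ~ finite_pred Y ->
  exists r, ray arc r /\ eventually_in r Y.
Proof.
  intros HE Ra Rb Ea Eb HY Yinf. set (x0 := a 0).
  destruct (finite_in_ball arc _ x0 Hconn HE) as [p Hp].
  destruct (finite_in_ball arc _ x0 Hconn HY) as [m Hm].
  assert (Hy : exists y, Y y /\ ~ ball (m + p) x0 y).
  { apply NNPP. intros K. apply Yinf. apply finite_sub with (2 := finite_ball arc (m + p) x0 Hlf).
    intros y Hy. apply NNPP. intros Hb. apply K. eauto. }
  destruct Hy as [y [Yy Hfar]].
  assert (Hdisj : forall u, ball p y u -> ball m x0 u -> False).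
  { intros u H1 H2. apply Hfar. apply ball_add with u; auto using ball_sym. }
  destruct (Hvt y x0) as [g [Hg Hgy]].
  destruct (automorphism_inverse arc g Hg) as [h [Hh [H1 H2]]].
  assert (Hmain : forall Z r, ray arc r -> eventually_in r (fun v => Z (h v)) ->
            (forall u, boundary Z u -> ball p y u) -> ~ Z x0 ->
            exists r, ray arc r /\ eventually_in r Y).
  { intros Z r Rr HrZ HZ Zx0.
    exists (fun n => h (r n)). split; [now apply ray_automorphism|].
    destruct HrZ as [N HN]. exists N. intros n Hn. specialize (HN n Hn).
    apply NNPP. intros Hno.
    assert (Hball : forall u, ball m x0 u -> ~ Z u).
    { intros u Hu. apply (ball_same_side arc m x0 (fun u => ~ Z u)) with x0;
        auto using ball_center.
      intros s t Hs Ht Hst Zs Zt. apply (Hdisj s); auto. apply HZ. exists t. auto. }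
    assert (HbY : forall u, ball p y u -> Y u).
    { intros u Hu. apply (ball_same_side arc p y Y) with y; auto using ball_center.
      intros s t Hs Ht Hst Ys. apply NNPP. intros Yt. apply (Hdisj s); auto.
      apply Hm. exists t. auto. }
    (* The boundary of [Z] lies in a ball inside [Y], and that of [Y] in a ball disjoint from [Z];
       so [Z] minus [Y] is closed under adjacency, yet it misses [y]. *)
    apply (no_proper_closed arc Hconn (fun v => Z v /\ ~ Y v) (h (r n)) y); auto.
    - intros s t [Zs Ys] Hst. split.
      + apply NNPP. intros Zt. apply Ys, HbY, HZ. exists t. auto.
      + intros Yt. apply (Hball s); auto. apply Hm. exists t. auto.
    - tauto. }
  assert (Hgb : forall u, boundary (fun v => E (g v)) u -> ball p y u).
  { intros u Hu. apply boundary_automorphism in Hu; auto. apply Hp in Hu.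
    rewrite <- Hgy in Hu. now apply automorphism_ball in Hu. }
  (* [Z] is taken to be the side of the translated cut that misses [x0]. *)
  destruct (classic (E (g x0))) as [Hx|Hx].
  - apply (Hmain (fun v => ~ E (g v)) b); auto.
    + apply eventually_in_sub with (2 := Eb). intros v. now rewrite H2.
    + intros u Hu. apply Hgb. now apply boundary_compl in Hu.
  - apply (Hmain (fun v => E (g v)) a); auto.
    apply eventually_in_sub with (2 := Ea). intros v. now rewrite H2.
Qed.

(** If [X] contains a tail of [a] and the part of [Z] outside [X] were infinite, that part, having
    finite boundary, would contain a ray tail, and this ray would belong to neither end. Otherwise
    the same applies to the complement of [X]. *)
Lemma side_not_split Z a b X :
  finite_pred (boundary Z) -> ray arc a -> ray arc b ->
  eventually_in a Z -> eventually_in b (fun v => ~ Z v) ->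
  (forall r, ray arc r -> ray_equiv arc r a \/ ray_equiv arc r b) ->
  finite_pred (boundary X) ->
  finite_pred (fun v => Z v /\ X v) \/ finite_pred (fun v => Z v /\ ~ X v).
Proof.
  intros HZ Ra Rb Za Zb Hends HX.
  assert (Hmain : forall X, finite_pred (boundary X) -> eventually_in a X ->
            finite_pred (fun v => Z v /\ ~ X v)).
  { clear X HX. intros X HX Xa. apply NNPP. intros Hinf.
    assert (HB : finite_pred (boundary (fun v => Z v /\ ~ X v))).
    { apply finite_sub with (2 := finite_or _ _ HZ HX). intros v Hv.
      destruct (boundary_and arc Z (fun v => ~ X v) v Hv); auto.
      right. now apply boundary_compl. }
    destruct (infinite_cut_contains_ray Z a b (fun v => Z v /\ ~ X v)) as [r [Rr Hr]]; auto.
    destruct (Hends r Rr) as [He|He].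
    - apply (ray_equiv_same_side arc r a _ Rr Ra He HB) in Hr.
      apply (eventually_in_disjoint a _ _ Hr Xa). tauto.
    - apply (ray_equiv_same_side arc r b _ Rr Rb He HB) in Hr.
      apply (eventually_in_disjoint b _ _ Hr Zb). tauto. }
  destruct (ray_same_side arc a X Ra HX) as [Xa|Xa]; auto.
  left. apply finite_sub with (B := fun v => Z v /\ ~ ~ X v); [tauto|].
  apply Hmain; auto. apply finite_sub with (2 := HX). apply boundary_compl.
Qed.

Hypothesis Hends : has_exactly_two_ends arc.

(** Applying [side_not_split] to [E] and to its complement leaves four cases: two would make [X]
    finite or cofinite, the other two give commensurability. *)
Lemma two_ended_cut : exists E : V -> Prop,
  finite_pred (boundary E) /\ ~ finite_pred E /\ ~ finite_pred (fun v => ~ E v) /\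
  forall X, finite_pred (boundary X) -> ~ finite_pred X -> ~ finite_pred (fun v => ~ X v) ->
    commens X E \/ commens X (fun v => ~ E v).
Proof.
  destruct Hends as [a [b [Ra [Rb [Hab Hall]]]]].
  destruct (separating_cut arc Hlf a b) as [E [HE [Ea Eb]]]; auto.
  exists E. repeat split; auto.
  - now apply eventually_in_infinite with a.
  - now apply eventually_in_infinite with b.
  - intros X HX X1 X2.
    assert (HE' : finite_pred (boundary (fun v => ~ E v))).
    { apply finite_sub with (2 := HE). apply boundary_compl. }
    assert (Ea' : eventually_in a (fun v => ~ ~ E v)).
    { apply eventually_in_sub with (2 := Ea). tauto. }
    assert (Hall' : forall r, ray arc r -> ray_equiv arc r b \/ ray_equiv arc r a).
    { intros r Hr. destruct (Hall r Hr); auto. }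
    destruct (side_not_split E a b X) as [H1|H1]; auto;
      destruct (side_not_split (fun v => ~ E v) b a X) as [H2|H2]; auto.
    + exfalso. apply X1. apply finite_sub with (2 := finite_or _ _ H1 H2).
      intros v. destruct (classic (E v)); tauto.
    + right. apply finite_sub with (2 := finite_or _ _ H1 H2).
      intros v. destruct (classic (E v)); tauto.
    + left. apply finite_sub with (2 := finite_or _ _ H1 H2).
      intros v. destruct (classic (E v)); tauto.
    + exfalso. apply X2. apply finite_sub with (2 := finite_or _ _ H1 H2).
      intros v. destruct (classic (E v)); tauto.
Qed.

Open Scope Z_scope.

Lemma two_ended_height : exists h : V -> Z,
  (forall g, automorphism arc g -> exists e, (e = 1 \/ e = -1) /\
     forall x y, h (g y) - h (g x) = e * (h y - h x)) /\
  (forall k, finite_pred (fun v => h v = k)).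
Proof.
  assert (Hinh : exists x0 : V, True) by (destruct Hends as [r _]; now exists (r 0%nat)).
  destruct Hinh as [x0 _].
  destruct two_ended_cut as [E [HE [E1 [E2 Hdich]]]].
  destruct (finite_in_ball arc _ x0 Hconn HE) as [R HR].
  set (E' := fun v => ~ E v).
  (* The pullback of [E] is again an infinite, coinfinite set with finite boundary, so
     [two_ended_cut] decides whether [g] fixes or exchanges the ends. *)
  assert (Hsign : forall g, automorphism arc g ->
    (commens (fun v => E (g v)) E /\ commens (fun v => E' (g v)) E') \/
    (commens (fun v => E (g v)) E' /\ commens (fun v => E' (g v)) E)).
  { intros g Hg. destruct (automorphism_inverse arc g Hg) as [h [Hh [H1 H2]]].
    assert (Hinf : forall X : V -> Prop, ~ finite_pred X -> ~ finite_pred (fun v => X (g v))).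
    { intros X HX K. apply HX. apply (finite_preimage _ h g H2) in K.
      apply finite_sub with (2 := K). intros v. now rewrite H2. }
    destruct (Hdich (fun v => E (g v))) as [K|K].
    - apply finite_sub with (2 := finite_preimage _ g h H1 HE).
      intros v. now apply boundary_automorphism.
    - now apply Hinf.
    - now apply (Hinf E').
    - left. split; auto. now apply (commens_compl (fun v => E (g v))).
    - right. split; auto. apply commens_trans with (fun v => ~ E' v).
      + now apply (commens_compl (fun v => E (g v))).
      + exists []. unfold E'. intros v. destruct (classic (E v)); tauto. }
  (* The radius [R] found at [x0] serves at every vertex: the pullback of [E], or of [E'] if the
     ends are exchanged, is the required representative. *)
  assert (Hloc : forall x, exists X0, commens X0 E /\ forall u, boundary X0 u -> ball R x u).
  { intros x. destruct (Hvt x x0) as [g [Hg Hgx]].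
    assert (Hb : forall u, boundary (fun v => E (g v)) u -> ball R x u).
    { intros u Hu. apply boundary_automorphism in Hu; auto. apply HR in Hu.
      rewrite <- Hgx in Hu. now apply automorphism_ball in Hu. }
    destruct (Hsign g Hg) as [[K1 K2]|[K1 K2]].
    - exists (fun v => E (g v)). auto.
    - exists (fun v => E' (g v)). split; auto. intros u Hu. apply Hb.
      now apply (boundary_compl arc (fun v => E (g v))). }
  assert (Hloc' : forall x, exists X0, commens X0 E' /\ forall u, boundary X0 u -> ball R x u).
  { intros x. destruct (Hloc x) as [X0 [K1 K2]]. exists (fun v => ~ X0 v).
    split; [now apply commens_compl|]. intros u Hu. now apply K2, boundary_compl. }
  (* Vertices of finite components lie on both sides and cancel; those of the ball lie on
     neither. *)
  set (w := fun x v => (if dec (on_side arc R E x v) then 1 else 0) -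
                       (if dec (on_side arc R E' x v) then 1 else 0)).
  assert (w_aut : forall g, automorphism arc g -> exists e, (e = 1 \/ e = -1) /\
            forall x v, w (g x) (g v) = e * w x v).
  { intros g Hg.
    destruct (Hsign g Hg) as [[K1 K2]|[K1 K2]]; [exists 1|exists (-1)]; (split; [lia|]);
      intros x v; unfold w;
      pose proof (on_side_automorphism arc g R E x v Hg) as L1;
      pose proof (on_side_automorphism arc g R E' x v Hg) as L2;
      pose proof (on_side_commens_sub arc R _ _ x v K1) as M1;
      pose proof (on_side_commens_sub arc R _ _ x v K2) as M2;
      pose proof (on_side_commens_sub arc R _ _ x v (commens_sym _ _ K1)) as M3;
      pose proof (on_side_commens_sub arc R _ _ x v (commens_sym _ _ K2)) as M4;
      destruct (dec (on_side arc R E (g x) (g v))), (dec (on_side arc R E' (g x) (g v))),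
        (dec (on_side arc R E x v)), (dec (on_side arc R E' x v)); try lia; exfalso; tauto. }
  assert (w_fin : forall x y, finite_pred (fun v => w x v - w y v <> 0)).
  { intros x y. destruct (Hloc x) as [X1 [A1 B1]], (Hloc y) as [X2 [A2 B2]],
      (Hloc' x) as [X3 [A3 B3]], (Hloc' y) as [X4 [A4 B4]].
    pose proof (commens_trans _ _ _ (on_side_commens arc Hconn Hlf R E X1 x A1 B1)
      (commens_sym _ _ (on_side_commens arc Hconn Hlf R E X2 y A2 B2))) as C1.
    pose proof (commens_trans _ _ _ (on_side_commens arc Hconn Hlf R E' X3 x A3 B3)
      (commens_sym _ _ (on_side_commens arc Hconn Hlf R E' X4 y A4 B4))) as C2.
    apply finite_sub with (2 := finite_or _ _ C1 C2). intros v. unfold w.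
    destruct (dec (on_side arc R E x v)), (dec (on_side arc R E' x v)),
      (dec (on_side arc R E y v)), (dec (on_side arc R E' y v)); solve [tauto|lia]. }
  assert (HD : exists D : V -> V -> Z, forall x y l, NoDup l ->
            (forall v, w x v - w y v <> 0 -> In v l) ->
            D x y = lsum (fun v => w x v - w y v) l).
  { assert (K : forall x y, exists k, forall l, NoDup l ->
            (forall v, w x v - w y v <> 0 -> In v l) ->
            k = lsum (fun v => w x v - w y v) l).
    { intros x y. destruct (finite_enum _ (w_fin x y)) as [l [H1 H2]].
      exists (lsum (fun v => w x v - w y v) l). intros m Hm H.
      apply lsum_support; auto. intros v. apply H2. }
    exists (fun x y => proj1_sig (constructive_indefinite_description _ (K x y))).
    intros x y. exact (proj2_sig (constructive_indefinite_description _ (K x y))). }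
  destruct HD as [D HD].
  assert (D_add : forall x y z, D x z - D x y = D y z).
  { intros x y z.
    destruct (finite_enum _ (finite_or _ _ (w_fin x y) (finite_or _ _ (w_fin x z) (w_fin y z))))
      as [l [H1 H2]].
    rewrite (HD x z l), (HD x y l), (HD y z l); auto; try (intros v Hv; apply H2; auto; fail).
    rewrite (lsum_ext (fun v => w x v - w z v) (fun v => (w x v - w y v) + (w y v - w z v)))
      by (intros; lia).
    rewrite lsum_add. lia. }
  exists (D x0). split.
  - intros g Hg. destruct (w_aut g Hg) as [e [He Hw]]. exists e. split; auto.
    intros x y. rewrite !D_add.
    destruct (finite_enum _ (w_fin x y)) as [l [H1 H2]].
    destruct (automorphism_inverse arc g Hg) as [h [Hh [Hgh Hhg]]].
    rewrite (HD x y l), (HD (g x) (g y) (map g l)); auto.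
    + rewrite lsum_map, <- lsum_scale. apply lsum_ext. intros v. rewrite !Hw. lia.
    + apply FinFun.Injective_map_NoDup; auto. intros a b. now apply automorphism_injective with arc.
    + intros v Hv. rewrite <- (Hhg v). apply in_map, H2.
      rewrite <- (Hhg v), !Hw in Hv. intros K. apply Hv. rewrite <- Z.mul_sub_distr_l, K. lia.
    + intros v. apply H2.
  - intros k. destruct (classic (exists x, D x0 x = k)) as [[x Hx]|Hno].
    2: { exists []. intros v Hv. apply Hno. eauto. }
    (* If the ball at [v] avoids both the ball and the finite components at [x], then nesting makes
       [D x v] nonzero; so the fibre of [x] lies in this finite set. *)
    apply finite_sub with (B := fun y =>
      exists u, (ball R x u \/ finite_piece arc R x u) /\ ball R u y).
    2: { apply finite_bind; [|intros; now apply finite_ball].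
         apply finite_or; [now apply finite_ball|now apply finite_finite_piece]. }
    intros v Hv. apply NNPP. intros Hfar.
    assert (F1 : forall u, ball R v u -> ~ ball R x u).
    { intros u H1 H2. apply Hfar. exists u. auto using ball_sym. }
    assert (F2 : forall u, ball R v u -> ~ finite_piece arc R x u).
    { intros u H1 H2. apply Hfar. exists u. auto using ball_sym. }
    assert (D0 : D x v = 0) by (rewrite <- (D_add x0); lia).
    destruct (finite_enum _ (w_fin x v)) as [l [H1 H2]].
    rewrite (HD x v l) in D0; auto; [|intros u; apply H2].
    assert (Hvv : forall X, ~ on_side arc R X v v).
    { intros X [A [_ [[A1 _] Av]]]. apply (A1 v Av), ball_center. }
    destruct (Hloc x) as [X0 [A0 B0]], (Hloc v) as [X1 [A1 B1]],
      (Hloc' v) as [X3 [A3 B3]].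
    assert (E'' : commens (fun u => ~ E' u) E).
    { exists []. unfold E'. intros u. destruct (classic (E u)); tauto. }
    (* In each case nesting gives all terms of the sum the same sign, and the term at [v] is
       nonzero: positive here, negative in the mirror case below, where the factor [-1] restores
       positivity. *)
    destruct (classic (X0 v)) as [Hv0|Hv0].
    + assert (Hle : forall u, 0 <= w x u - w v u).
      { intros u. unfold w.
        pose proof (far_on_side_sub arc Hconn Hlf R E X0 x v E2 A0 B0 F1 Hv0 u) as M1.
        pose proof (far_on_opposite_side_sup arc Hconn Hlf R E X0 X1 x v E2 A0 A1 B0 B1 F1 F2 Hv0 u)
          as M2. fold E' in M2.
        destruct (dec (on_side arc R E x u)), (dec (on_side arc R E' x u)),
          (dec (on_side arc R E v u)), (dec (on_side arc R E' v u)); solve [tauto|lia]. }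
      assert (Hlt : 0 < w x v - w v v).
      { destruct (far_point_on_side arc Hlf R E X0 x v A0 B0 F1 F2 Hv0) as [M1 M2].
        fold E' in M2. pose proof (Hvv E). pose proof (Hvv E'). unfold w.
        destruct (dec (on_side arc R E x v)), (dec (on_side arc R E' x v)),
          (dec (on_side arc R E v v)), (dec (on_side arc R E' v v)); solve [tauto|lia]. }
      pose proof (lsum_pos _ l v Hle) as Hp. cbv beta in Hp.
      assert (In v l) by (apply H2; lia). specialize (Hp H Hlt). lia.
    + assert (Hv2 : ~ X0 v) by auto. set (Y0 := fun u => ~ X0 u).
      assert (C0 : commens Y0 E') by now apply commens_compl.
      assert (C1 : forall u, boundary Y0 u -> ball R x u).
      { intros u Hu. now apply B0, boundary_compl. }
      assert (Einf : ~ finite_pred (fun u => ~ E' u)).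
      { intros K. apply E1. apply finite_sub with (2 := K). unfold E'. tauto. }
      assert (Hside : forall y u, on_side arc R (fun t => ~ E' t) y u <-> on_side arc R E y u).
      { intros y u. split; apply on_side_commens_sub; auto using commens_sym. }
      assert (Hle : forall u, 0 <= -1 * (w x u - w v u)).
      { intros u. unfold w.
        pose proof (far_on_side_sub arc Hconn Hlf R E' Y0 x v Einf C0 C1 F1 Hv2 u) as M1.
        pose proof (far_on_opposite_side_sup arc Hconn Hlf R E' Y0 X3 x v Einf C0 A3 C1 B3 F1 F2
          Hv2 u) as M2. rewrite !Hside in M2.
        destruct (dec (on_side arc R E x u)), (dec (on_side arc R E' x u)),
          (dec (on_side arc R E v u)), (dec (on_side arc R E' v u)); solve [tauto|lia]. }
      assert (Hlt : 0 < -1 * (w x v - w v v)).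
      { destruct (far_point_on_side arc Hlf R E' Y0 x v C0 C1 F1 F2 Hv2) as [M1 M2].
        rewrite Hside in M2. pose proof (Hvv E). pose proof (Hvv E'). unfold w.
        destruct (dec (on_side arc R E x v)), (dec (on_side arc R E' x v)),
          (dec (on_side arc R E v v)), (dec (on_side arc R E' v v)); solve [tauto|lia]. }
      pose proof (lsum_pos _ l v Hle) as Hp. cbv beta in Hp. rewrite lsum_scale in Hp.
      assert (In v l) by (apply H2; lia). specialize (Hp H Hlt). lia.
Qed.

End TwoEnded.

(** * The layering *)

Section Layering.

Context {V : Type} (arc : V -> V -> Prop).
Hypothesis Hdig : is_digraph arc.
Hypothesis Hconn : connected arc.
Hypothesis Hlf : locally_finite arc.
Hypothesis Hch : connected_homogeneous arc.
Hypothesis Hends : has_exactly_two_ends arc.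
Notation adj := (adj arc).
Open Scope Z_scope.

Lemma two_ended_infinite : ~ finite_pred (fun _ : V => True).
Proof.
  destruct Hends as [r [_ [Hr _]]]. apply (eventually_in_infinite arc r); auto. now exists 0%nat.
Qed.

Lemma two_ended_has_arc : exists x y, arc x y.
Proof. destruct Hends as [r [_ [[_ Hr] _]]]. destruct (Hr 0%nat) as [H|H]; eauto. Qed.

Lemma homogeneous_in_neighbour y : exists x, arc x y.
Proof.
  destruct two_ended_has_arc as [a [b Hab]].
  destruct (homogeneous_vertex_transitive arc Hdig Hch b y) as [g [Hg <-]].
  exists (g a). now apply automorphism_arc.
Qed.

Lemma homogeneous_out_neighbour x : exists y, arc x y.
Proof.
  destruct two_ended_has_arc as [a [b Hab]].
  destruct (homogeneous_vertex_transitive arc Hdig Hch a x) as [g [Hg <-]].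
  exists (g b). now apply automorphism_arc.
Qed.

Lemma layering_exists : exists h : V -> Z,
  (forall x y, arc x y -> h y = h x + 1) /\ (forall k, finite_pred (fun v => h v = k)).
Proof.
  destruct (two_ended_height arc Hconn Hlf (homogeneous_vertex_transitive arc Hdig Hch) Hends)
    as [h [Haut Hfin]].
  destruct two_ended_has_arc as [x1 [y1 H1]].
  set (d := h y1 - h x1).
  assert (Harc : forall x y, arc x y -> h y - h x = d \/ h y - h x = - d).
  { intros x y Hxy.
    destruct (homogeneous_arc_transitive arc Hdig Hch x1 y1 x y) as [g [Hg [<- <-]]]; auto.
    destruct (Haut g Hg) as [e [He Hh]]. rewrite Hh. unfold d. destruct He; subst e; lia. }
  assert (Hadj : forall x y, adj x y -> h y - h x = d \/ h y - h x = - d).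
  { intros x y [H|H]; apply Harc in H; lia. }
  assert (Hd : d <> 0).
  { intros K. apply two_ended_infinite. apply finite_sub with (2 := Hfin (h x1)).
    intros v _. apply (connected_invariant arc (fun v => h v = h x1) Hconn) with x1; auto.
    intros a b Ha Hab. apply Hadj in Hab. lia. }
  (* Increments along arcs are all [d] or [-d], so a triangle would violate parity and every
     directed 2-path is induced. *)
  assert (Htwo : forall x y z x' y' z', arc x y -> arc y z -> arc x' y' -> arc y' z' ->
            h z = h x -> h z' = h x').
  { intros x y z x' y' z' Hxy Hyz Hxy' Hyz' E.
    assert (N : forall a b c, arc a b -> arc b c -> ~ adj a c).
    { intros a b c Hab Hbc Hac. apply Harc in Hab, Hbc. apply Hadj in Hac. lia. }
    destruct (homogeneous_two_arc_transitive arc Hdig Hch x y z x' y' z')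
      as [g [Hg [<- [<- <-]]]]; eauto.
    destruct (Haut g Hg) as [e [He Hh]]. specialize (Hh x z). rewrite E in Hh. lia. }
  destruct (homogeneous_out_neighbour y1) as [z1 Hz1].
  (* By [Htwo], either all directed 2-paths return to their starting height or none does. *)
  destruct (Z.eq_dec (h z1) (h x1)) as [E|E].
  - exfalso.
    (* In the returning case all neighbours of a vertex share one height, so [h] takes only two
       values, which is impossible for finite fibres in an infinite graph. *)
    assert (Hnb : forall y u v, adj y u -> adj y v -> h u = h v).
    { intros y. destruct (homogeneous_in_neighbour y) as [x Hx].
      destruct (homogeneous_out_neighbour y) as [z Hz].
      assert (L : forall a b, arc a y -> arc y b -> h b = h a).
      { intros a b Ha Hb. now apply (Htwo x1 y1 z1 a y b). }
      intros u v [Hu|Hu] [Hv|Hv].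
      - rewrite (L x u Hx Hu), (L x v Hx Hv). auto.
      - auto.
      - symmetry. auto.
      - rewrite <- (L u z Hu Hz), <- (L v z Hv Hz). auto. }
    apply two_ended_infinite.
    apply finite_sub with (2 := finite_or _ _ (Hfin (h x1)) (Hfin (h y1))).
    intros v _.
    assert (P : (h v = h x1 /\ forall u, adj v u -> h u = h y1) \/
                (h v = h y1 /\ forall u, adj v u -> h u = h x1)); [|tauto].
    apply (connected_invariant arc (fun v => (h v = h x1 /\ forall u, adj v u -> h u = h y1) \/
                (h v = h y1 /\ forall u, adj v u -> h u = h x1)) Hconn) with x1.
    + intros a b [[Ha Na]|[Ha Na]] Hab; [right|left]; (split; [auto|]); intros u Hu;
        rewrite <- Ha; apply (Hnb b); auto using adj_sym.
    + left. split; auto. intros u Hu. apply (Hnb x1); auto. now left.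
  - assert (Hloc : forall a y b, arc a y -> arc y b -> h b - h y = h y - h a).
    { intros a y b Ha Hb. pose proof (Harc _ _ Ha). pose proof (Harc _ _ Hb).
      assert (h b <> h a) by (intros K; apply E; now apply (Htwo a y b x1 y1 z1)). lia. }
    (* By [Hloc], increment [d] on one arc at a vertex spreads to all arcs there, and so through the
       connected graph. *)
    set (P := fun v => (forall u, arc u v -> h v - h u = d) /\ (forall u, arc v u -> h u - h v = d)).
    assert (Pin : forall a y, arc a y -> h y - h a = d -> P y).
    { intros a y Ha Hd'.
      assert (K : forall u, arc y u -> h u - h y = d) by (intros u Hu; rewrite (Hloc a y u); auto).
      split; auto. intros u Hu. destruct (homogeneous_out_neighbour y) as [z Hz].
      rewrite <- (Hloc u y z); auto. }
    assert (Pout : forall y b, arc y b -> h b - h y = d -> P y).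
    { intros y b Hb Hd'. destruct (homogeneous_in_neighbour y) as [x Hx].
      apply (Pin x y); auto. rewrite <- (Hloc x y b); auto. }
    assert (HP : forall v, P v).
    { intros v. apply (connected_invariant arc P Hconn) with y1.
      - intros a b [Pa1 Pa2] [Hab|Hab]; [apply (Pin a b)|apply (Pout b a)]; auto.
      - now apply (Pin x1 y1). }
    assert (Hk : forall v, exists k, h v - h x1 = k * d).
    { intros v. apply (connected_invariant arc (fun v => exists k, h v - h x1 = k * d) Hconn) with x1.
      - intros a b [k Ka] Hab. apply Hadj in Hab. destruct Hab; [exists (k + 1)|exists (k - 1)]; lia.
      - exists 0. lia. }
    (* Heights differ from [h x1] by multiples of [d], so the division is exact; it turns the
       increment into 1 whatever the sign of [d]. *)
    exists (fun v => (h v - h x1) / d). split.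
    + intros x y Hxy. destruct (Hk x) as [k Ek].
      assert (Ey : h y - h x1 = (k + 1) * d) by (pose proof (proj2 (HP x) y Hxy); lia).
      rewrite Ek, Ey, !Z.div_mul; auto.
    + intros k. apply finite_sub with (2 := Hfin (h x1 + k * d)). intros v Hv.
      destruct (Hk v) as [k' Ek]. rewrite Ek, Z.div_mul in Hv; auto. subst. lia.
Qed.

End Layering.

(** * Twins in layered connected-homogeneous digraphs *)

Section Layered.

Context {V : Type} (arc : V -> V -> Prop) (h : V -> Z).
Hypothesis Hdig : is_digraph arc.
Hypothesis Hconn : connected arc.
Hypothesis Hlf : locally_finite arc.
Hypothesis Hch : connected_homogeneous arc.
Hypothesis Hh : forall x y, arc x y -> h y = (h x + 1)%Z.
Hypothesis Hfin : forall k, finite_pred (fun v => h v = k).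
Hypothesis Hin : forall y, exists x, arc x y.
Hypothesis Hout : forall x, exists y, arc x y.
Notation adj := (adj arc).
Open Scope Z_scope.

Let Hvt := homogeneous_vertex_transitive arc Hdig Hch.

Lemma automorphism_height g x y : automorphism arc g -> h (g y) - h (g x) = h y - h x.
Proof.
  intros Hg.
  enough (K : h (g y) - h y = h (g x) - h x) by lia.
  apply (connected_invariant arc (fun v => h (g v) - h v = h (g x) - h x) Hconn) with x; auto.
  intros a b Ha [H|H]; pose proof (Hh _ _ H); apply (automorphism_arc arc g) in H; auto;
    apply Hh in H; lia.
Qed.

Lemma ball_height n x y : ball arc n x y -> h y <= h x + Z.of_nat n.
Proof.
  revert y. induction n as [|n IH]; intros y Hy.
  - simpl in Hy. subst. lia.
  - destruct Hy as [Hy|[z [Hz [H|H]]]].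
    + apply IH in Hy. lia.
    + apply IH in Hz. apply Hh in H. lia.
    + apply IH in Hz. apply Hh in H. lia.
Qed.

(** Attaches an upward directed path. When [S] lies below the new top, [u] is the only vertex of its
    layer in [S'], hence the only one that can be joined to children of [u]. *)
Lemma climb S s n : finite_pred S -> induced_connected arc S -> S s ->
  exists S' u, finite_pred S' /\ induced_connected arc S' /\ (forall v, S v -> S' v) /\ S' u /\
    h u = h s + Z.of_nat n /\ forall v, S' v -> S v \/ h v < h u \/ v = u.
Proof.
  intros Sf Sc Ss. induction n as [|n IH].
  - exists S, s. repeat split; auto. lia.
  - destruct IH as [S' [u [H1 [H2 [H3 [H4 [H5 H6]]]]]]].
    destruct (Hout u) as [u' Hu]. pose proof (Hh _ _ Hu).
    exists (fun v => S' v \/ v = u'), u'. repeat split; auto.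
    + apply finite_or; auto using finite_eq.
    + apply induced_connected_add with u; auto. now left.
    + lia.
    + intros v [Hv| ->]; auto. destruct (H6 v Hv) as [K|[K| ->]]; auto; right; left; lia.
Qed.

Lemma descend w n :
  exists S a, finite_pred S /\ induced_connected arc S /\ S w /\ S a /\
    h a = h w - Z.of_nat n /\ forall v, S v -> h v <= h w.
Proof.
  induction n as [|n IH].
  - exists (fun v => v = w), w. repeat split; auto using finite_eq, induced_connected_eq; try lia.
    intros v ->. lia.
  - destruct IH as [S [a [H1 [H2 [H3 [H4 [H5 H6]]]]]]].
    destruct (Hin a) as [b Hb]. pose proof (Hh _ _ Hb).
    exists (fun v => S v \/ v = b), b. repeat split; auto; try lia.
    + apply finite_or; auto using finite_eq.
    + apply induced_connected_add with a; auto. now right.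
    + intros v [Hv| ->]; auto. lia.
Qed.

(** Descend [n] steps from both vertices, where [n] bounds distances from [w] within its layer, and
    join the two endpoints by a ball of radius [n]. Such a ball rises by at most [n] layers. *)
Lemma connected_from_below w w' : h w = h w' ->
  exists S, finite_pred S /\ induced_connected arc S /\ S w /\ S w' /\
    forall v, S v -> h v <= h w.
Proof.
  intros E. destruct (finite_in_ball arc _ w Hconn (Hfin (h w))) as [n Hn].
  destruct (descend w n) as [S1 [a [A1 [A2 [A3 [A4 [A5 A6]]]]]]].
  destruct (descend w' n) as [S2 [b [B1 [B2 [B3 [B4 [B5 B6]]]]]]].
  (* An automorphism taking [a] to [w] transfers the bound [n] to the layer of [a]. *)
  assert (Hb : ball arc n a b).
  { destruct (Hvt a w) as [g [Hg Hga]]. apply (automorphism_ball arc g); auto.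
    rewrite Hga. apply Hn. pose proof (automorphism_height g a b Hg). rewrite Hga in H. lia. }
  exists (fun v => (S1 v \/ ball arc n a v) \/ S2 v). repeat split; auto.
  - apply finite_or; auto. apply finite_or; auto using finite_ball.
  - apply induced_connected_union with b; auto.
    apply induced_connected_union with a; auto using ball_induced_connected, ball_center.
  - intros v [[Hv|Hv]|Hv]; auto.
    + apply ball_height in Hv. lia.
    + apply B6 in Hv. lia.
Qed.

Definition in_twins a b := forall w, arc w a <-> arc w b.

Lemma automorphism_in_twins g a b : automorphism arc g -> in_twins a b -> in_twins (g a) (g b).
Proof.
  intros Hg Hab w. destruct (automorphism_inverse arc g Hg) as [k [Hk [_ H2]]].
  rewrite <- (H2 w), !automorphism_arc; auto.
Qed.

(* Without distinct in-twins, an automorphism fixing one layer fixes all the layers above it;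
   but homogeneity lets it move one child of a high vertex to another. *)
Lemma in_twins_exist u z z' : arc u z -> arc u z' -> z <> z' ->
  exists a b, a <> b /\ in_twins a b.
Proof.
  intros Hz Hz' Hne. apply NNPP. intros Hno.
  assert (Htw : forall a b, in_twins a b -> a = b).
  { intros a b Hab. apply NNPP. intros K. apply Hno. eauto. }
  destruct (finite_in_ball arc _ u Hconn (Hfin (h u))) as [n Hn].
  (* Climbing one step more than the radius puts the ball strictly below [t], so [t] is the only
     vertex of [S] that can be adjacent to [g z] or [g z']. *)
  destruct (climb (ball arc n u) u (S n)) as [S [t [S1 [S2 [S3 [S4 [S5 S6]]]]]]];
    auto using finite_ball, ball_induced_connected, ball_center.
  assert (Stop : forall v, S v -> h v < h t \/ v = t).
  { intros v Hv. destruct (S6 v Hv) as [K|K]; auto. apply ball_height in K. left. lia. }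
  destruct (Hvt u t) as [g [Hg Hgu]].
  assert (Ha : arc t (g z)) by (rewrite <- Hgu, automorphism_arc; auto).
  assert (Hb : arc t (g z')) by (rewrite <- Hgu, automorphism_arc; auto).
  pose proof (Hh _ _ Ha) as La. pose proof (Hh _ _ Hb) as Lb.
  destruct (homogeneous_extend_one arc Hdig Hch S t (g z) (g z')) as [k [Hk [Hks Hkz]]]; auto.
  - now left.
  - now left.
  - intros K. apply Stop in K. destruct K as [K|K]; [lia|]. rewrite K in La. lia.
  - intros K. apply Stop in K. destruct K as [K|K]; [lia|]. rewrite K in Lb. lia.
  - intros s Hs. destruct (Stop s Hs) as [K| ->]; [|tauto].
    split; intros L; apply Hh in L; lia.
  - intros s Hs. destruct (Stop s Hs) as [K| ->]; split; intros L; apply Hh in L; lia.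
  - assert (Hparents : forall v, (forall w, arc w v -> k w = w) -> in_twins v (k v)).
    { intros v Hv w. split; intros Hw.
      - rewrite <- (Hv w Hw). now apply automorphism_arc.
      - destruct (automorphism_inverse arc k Hk) as [k' [_ [_ H2]]].
        rewrite <- (H2 w), automorphism_arc in Hw; auto.
        rewrite <- (H2 w). now rewrite (Hv _ Hw). }
    assert (Hfix : forall j v, h v = h u + Z.of_nat j -> k v = v).
    { induction j as [|j IH]; intros v Hv.
      - apply Hks, S3, Hn. lia.
      - symmetry. apply Htw, Hparents. intros w Hw. apply IH. apply Hh in Hw. lia. }
    apply Hne. apply (automorphism_injective arc g); auto. rewrite <- Hkz.
    apply Htw, Hparents. intros w Hw. apply Hh in Hw.
    apply (Hfix (Z.to_nat (h t - h u))). lia.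
Qed.

(** Distinct in-twins are siblings, as every vertex has an in-neighbour, and homogeneity carries one
    pair of distinct siblings to any other. *)
Lemma siblings_in_twins u z z' w : arc u z -> arc u z' -> arc w z -> arc w z'.
Proof.
  intros Hz Hz' Hw. destruct (classic (z = z')) as [->|Hne]; auto.
  destruct (in_twins_exist u z z') as [a [b [Nab Hab]]]; auto.
  destruct (Hin a) as [t Ha]. assert (Hb : arc t b) by now apply Hab.
  assert (N : forall t a b, arc t a -> arc t b -> ~ adj a b).
  { intros t' a' b' H1 H2 [H3|H3]; apply Hh in H1, H2, H3; lia. }
  destruct (homogeneous_siblings_transitive arc Hdig Hch t a b u z z')
    as [g [Hg [_ [<- <-]]]]; eauto.
  now apply (automorphism_in_twins g a b).
Qed.

(** Let [w'] be an in-neighbour of [v], and join [w] to [w'] from below. An automorphism [g] fixing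
    this set and [v] moves [u] to [u']. Then [z] and [g z] are both children of [v], hence in-twins,
    and [u'] is an in-neighbour of [g z]. *)
Lemma siblings_common_child w u u' v z :
  arc w u -> arc w u' -> arc u z -> arc v z -> v <> u -> arc u' z.
Proof.
  intros Hu Hu' Hz Hv Nvu. destruct (classic (v = u')) as [->|Nvu']; auto.
  destruct (Hin v) as [w' Hw'].
  pose proof (Hh _ _ Hu). pose proof (Hh _ _ Hu'). pose proof (Hh _ _ Hz).
  pose proof (Hh _ _ Hv). pose proof (Hh _ _ Hw').
  destruct (connected_from_below w w') as [S [S1 [S2 [S3 [S4 S5]]]]]; [lia|].
  destruct (homogeneous_extend_one arc Hdig Hch (fun s => S s \/ s = v) w u u')
    as [g [Hg [Hgs Hgu]]]; auto; try (now left).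
  - apply finite_or; auto using finite_eq.
  - apply induced_connected_add with w'; auto. now left.
  - intros [K|K]; [|now subst]. apply S5 in K. lia.
  - intros [K|K]; [|now subst]. apply S5 in K. lia.
  - intros s _. split; apply siblings_in_twins with w; auto.
  - intros s [Hs| ->]; split; intros K; apply Hh in K; try (apply S5 in Hs); lia.
  - apply siblings_in_twins with (u := v) (z := g z); auto.
    + rewrite <- (Hgs v), automorphism_arc; auto.
    + rewrite <- Hgu, automorphism_arc; auto.
Qed.

(** Automorphisms shift layers, so by vertex-transitivity all layers are images of one another. *)
Lemma layer_enum : exists (r : nat) (L : Z -> list V),
  forall k, NoDup (L k) /\ (forall v, In v (L k) <-> h v = k) /\ length (L k) = r.
Proof.
  destruct (classic (exists x : V, True)) as [[x _]|Hempty].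
  2: { exists 0%nat, (fun _ => []). intros k. repeat split; simpl; auto using NoDup_nil; [tauto|].
       intros _. apply Hempty. eauto. }
  destruct (finite_enum _ (Hfin (h x))) as [l [H1 H2]].
  assert (Hlev : forall k, exists y, h y = h x + k).
  { assert (U : forall n, exists y, h y = h x + Z.of_nat n).
    { induction n as [|n [y Hy]]; [exists x; lia|].
      destruct (Hout y) as [z Hz]. apply Hh in Hz. exists z. lia. }
    intros k. destruct (Z_le_gt_dec 0 k).
    - destruct (U (Z.to_nat k)) as [y Hy]. exists y. lia.
    - destruct (descend x (Z.to_nat (- k))) as [_ [a [_ [_ [_ [_ [Ha _]]]]]]]. exists a. lia. }
  assert (K : forall k, exists m, NoDup m /\ (forall v, In v m <-> h v = k) /\ length m = length l).
  { intros k. destruct (Hlev (k - h x)) as [y Hy].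
    destruct (Hvt x y) as [g [Hg Hgx]].
    destruct (automorphism_inverse arc g Hg) as [g' [Hg' [G1 G2]]].
    exists (map g l). split; [|split; [|apply length_map]].
    - apply FinFun.Injective_map_NoDup; auto. intros a b. now apply automorphism_injective with arc.
    - intros v. rewrite in_map_iff. split.
      + intros [a [<- Ha]]. apply H2 in Ha. pose proof (automorphism_height g x a Hg).
        rewrite Hgx in H. lia.
      + intros Hv. exists (g' v). split; auto. apply H2.
        pose proof (automorphism_height g x (g' v) Hg). rewrite Hgx, G2 in H. lia. }
  exists (length l), (fun k => proj1_sig (constructive_indefinite_description _ (K k))).
  intros k. exact (proj2_sig (constructive_indefinite_description _ (K k))).
Qed.

(* The parent map is a surjection between layers of equal size. *)
Lemma unique_parent_unique_child x z z' :
  (forall x y z, arc x z -> arc y z -> x = y) -> arc x z -> arc x z' -> z = z'.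
Proof.
  intros Hpar Hz Hz'. destruct layer_enum as [r [L HL]].
  destruct (Hvt x z) as [g [Hg Hgx]].
  destruct (automorphism_inverse arc g Hg) as [g' [Hg' [G1 G2]]].
  set (p := fun y => epsilon (inhabits x) (fun w => arc w y)).
  assert (Hp : forall y, arc (p y) y) by (intros y; apply epsilon_spec, Hin).
  destruct (HL (h z)) as [A1 [A2 A3]]. pose proof (Hh _ _ Hz). pose proof (Hh _ _ Hz').
  (* [g] brings the parents back into the layer of [z], so this is a surjective self-map of a finite
     list, which must be injective. *)
  assert (N : NoDup (map (fun y => g (p y)) (L (h z)))).
  { apply NoDup_incl_NoDup with (l := L (h z)); auto; [now rewrite length_map|].
    intros y Hy. apply A2 in Hy. apply in_map_iff.
    destruct (Hout (g' y)) as [t Ht]. exists t. split.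
    - now rewrite (Hpar (p t) (g' y) t).
    - apply A2. apply Hh in Ht. pose proof (automorphism_height g x (g' y) Hg).
      rewrite Hgx, G2 in H1. lia. }
  apply (NoDup_map_injective _ _ z z' N); [apply A2; auto|apply A2; lia|].
  f_equal. apply (Hpar _ _ z); auto. now rewrite (Hpar (p z') x z').
Qed.

(** If [z] has a second in-neighbour, [siblings_common_child] applies. Otherwise arc-transitivity
    makes in-neighbours unique throughout, and counting forces [u = u']. *)
Lemma siblings_out_twins w u u' z : arc w u -> arc w u' -> arc u z -> arc u' z.
Proof.
  intros Hu Hu' Hz.
  destruct (classic (exists v, arc v z /\ v <> u)) as [[v [Hv Nv]]|Hno].
  - now apply (siblings_common_child w u u' v z).
  - replace u' with u; auto. apply unique_parent_unique_child with w; auto.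
    intros a b t Ha Hb. apply NNPP. intros Nab. apply Hno.
    destruct (homogeneous_arc_transitive arc Hdig Hch a t u z) as [g [Hg [<- <-]]]; auto.
    exists (g b). split; [now apply automorphism_arc|].
    intros E. apply automorphism_injective with (1 := Hg) in E. auto.
Qed.

End Layered.

(** * Layered homogeneous digraphs are complete between consecutive layers *)

Section Complete.

Context {V : Type} (arc : V -> V -> Prop) (h : V -> Z).
Hypothesis Hdig : is_digraph arc.
Hypothesis Hconn : connected arc.
Hypothesis Hlf : locally_finite arc.
Hypothesis Hch : connected_homogeneous arc.
Hypothesis Hh : forall x y, arc x y -> h y = (h x + 1)%Z.
Hypothesis Hfin : forall k, finite_pred (fun v => h v = k).
Hypothesis Hin : forall y, exists x, arc x y.
Hypothesis Hout : forall x, exists y, arc x y.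
Open Scope Z_scope.

Let rarc := fun x y => arc y x.

(** An equality rather than an equivalence, so that it can be rewritten inside the connectedness
    predicates. *)
Lemma adj_rev : adj rarc = adj arc.
Proof.
  apply functional_extensionality. intros x. apply functional_extensionality. intros y.
  apply propositional_extensionality. unfold adj, rarc. tauto.
Qed.

Lemma automorphism_rev g : automorphism arc g -> automorphism rarc g.
Proof. intros [H1 H2]. split; auto. intros x y. apply H2. Qed.

Lemma connected_homogeneous_rev : connected_homogeneous rarc.
Proof.
  intros A B f HA HB CA CB [I1 [I2 [I3 I4]]].
  unfold induced_connected, adj_in in CA, CB. rewrite adj_rev in CA, CB.
  destruct (Hch A B f) as [g [Hg Hgf]]; auto.
  - repeat split; auto; apply (I4 y x); auto.
  - exists g. split; auto using automorphism_rev.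
Qed.

(** The two sibling lemmas for the reversed digraph, layered by [- h]. *)
Lemma cosiblings_twins u u' w z : arc u z -> arc u' z ->
  (arc w u -> arc w u') /\ (forall t, arc u t -> arc u' t).
Proof.
  intros Hu Hu'.
  assert (D1 : is_digraph rarc).
  { destruct Hdig as [H1 H2]. split; [exact H1|]. intros x y Hxy Hyx. now apply (H2 x y). }
  assert (D2 : connected rarc) by (unfold connected; rewrite adj_rev; exact Hconn).
  assert (D3 : locally_finite rarc) by (intros x; destruct (Hlf x); auto).
  pose proof connected_homogeneous_rev as D4.
  assert (D5 : forall x y, rarc x y -> - h y = - h x + 1).
  { intros x y Hxy. apply Hh in Hxy. lia. }
  assert (D6 : forall k, finite_pred (fun v => - h v = k)).
  { intros k. apply finite_sub with (2 := Hfin (- k)). intros v. lia. }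
  split.
  - apply (siblings_out_twins rarc (fun v => - h v) D1 D2 D3 D4 D5 D6 Hout Hin z); auto.
  - intros t. apply (siblings_in_twins rarc (fun v => - h v) D1 D2 D3 D4 D5 D6 Hout Hin z); auto.
Qed.

(** A directed double ray [c] through [x] meets every layer. By induction along edges each vertex is
    a twin of the vertex of [c] in its layer, so [y] inherits the arc from [x] to [c 1]. *)
Lemma layers_complete x y : h y = h x + 1 -> arc x y.
Proof.
  set (s := fun v => epsilon (inhabits x) (fun w => arc v w)).
  set (p := fun v => epsilon (inhabits x) (fun w => arc w v)).
  assert (Hs : forall v, arc v (s v)) by (intros v; apply epsilon_spec, Hout).
  assert (Hp : forall v, arc (p v) v) by (intros v; apply epsilon_spec, Hin).
  set (c := fun i => if Z_le_gt_dec 0 i then Nat.iter (Z.to_nat i) s x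
                     else Nat.iter (Z.to_nat (- i)) p x).
  assert (Hc : forall i, arc (c i) (c (i + 1))).
  { intros i. unfold c. destruct (Z_le_gt_dec 0 i), (Z_le_gt_dec 0 (i + 1)); try lia.
    - replace (Z.to_nat (i + 1)) with (S (Z.to_nat i)) by lia. apply Hs.
    - replace i with (-1) by lia. apply Hp.
    - replace (Z.to_nat (- i)) with (S (Z.to_nat (- (i + 1)))) by lia. apply Hp. }
  set (tw := fun a b => forall v, (arc v a <-> arc v b) /\ (arc a v <-> arc b v)).
  assert (T1 : forall u a b, arc u a -> arc u b -> tw a b).
  { intros u a b Ha Hb v. split; split.
    - now apply (siblings_in_twins arc h Hdig Hconn Hlf Hch Hh Hfin Hin Hout u).
    - now apply (siblings_in_twins arc h Hdig Hconn Hlf Hch Hh Hfin Hin Hout u).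
    - now apply (siblings_out_twins arc h Hdig Hconn Hlf Hch Hh Hfin Hin Hout u).
    - now apply (siblings_out_twins arc h Hdig Hconn Hlf Hch Hh Hfin Hin Hout u). }
  assert (T2 : forall u a b, arc a u -> arc b u -> tw a b).
  { intros u a b Ha Hb v. split; split; now apply (cosiblings_twins _ _ v u). }
  assert (Hall : forall v, tw v (c (h v - h x))).
  { intros v. apply (connected_invariant arc (fun v => tw v (c (h v - h x))) Hconn) with x.
    (* The twin of [a] on [c] is joined to [b] just as [a] is; so [b] and the adjacent vertex of [c]
       in its layer share an in-neighbour or an out-neighbour. *)
    - intros a b Ha [Hab|Hab]; pose proof (Hh _ _ Hab).
      + apply (T1 (c (h a - h x))); [now apply Ha|].
        replace (h b - h x) with (h a - h x + 1) by lia. apply Hc.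
      + apply (T2 (c (h a - h x))); [now apply Ha|].
        replace (h a - h x) with (h b - h x + 1) by lia. apply Hc.
    - rewrite Z.sub_diag. intros v'. simpl. tauto. }
  intros Hy. apply (Hall y).
  replace (h y - h x) with (0 + 1) by lia. apply (Hc 0).
Qed.

End Complete.

(** * Identification with [Jarc r] *)

Lemma list_sig {A : Type} (P : A -> Prop) l : Forall P l ->
  exists m : list {x | P x}, map (@proj1_sig A P) m = l.
Proof.
  induction 1 as [|a l Ha _ [m Hm]]; [now exists []|].
  exists (exist P a Ha :: m). simpl. now rewrite Hm.
Qed.

Lemma interval_enum r : exists m : list {x : nat | (1 <= x <= r)%nat},
  NoDup m /\ length m = r /\ forall i, In i m.
Proof.
  destruct (list_sig (fun x => (1 <= x <= r)%nat) (seq 1 r)) as [m Hm].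
  { apply Forall_forall. intros x Hx. apply in_seq in Hx. lia. }
  exists m. repeat split.
  - apply (NoDup_map_inv (@proj1_sig _ _)). rewrite Hm. apply seq_NoDup.
  - rewrite <- (length_seq r 1), <- Hm. symmetry. apply length_map.
  - intros [x Hx].
    assert (K : In x (map (@proj1_sig _ _) m)) by (rewrite Hm; apply in_seq; lia).
    apply in_map_iff in K. destruct K as [[x' Hx'] [E Hin]]. simpl in E. subst x'.
    now rewrite (proof_irrelevance _ Hx Hx').
Qed.

(** Arcs depend on heights alone, so each layer may be numbered independently and arbitrarily. *)
Lemma complete_layers_isomorphic {V : Type} (arc : V -> V -> Prop) (h : V -> Z) r
  (L : Z -> list V) (x0 : V) :
  (forall x y, arc x y <-> h y = (h x + 1)%Z) ->
  (forall k, NoDup (L k) /\ (forall v, In v (L k) <-> h v = k) /\ length (L k) = r) ->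
  isomorphic arc (Jarc r).
Proof.
  intros Harc HL. destruct (interval_enum r) as [m [M1 [M2 M3]]].
  (* The layer of [x0] is nonempty, so [r] is positive and a default index exists. *)
  assert (Hi : exists i : {x : nat | (1 <= x <= r)%nat}, True).
  { destruct (HL (h x0)) as [_ [A2 A3]]. assert (K : In x0 (L (h x0))) by now apply A2.
    destruct m as [|i m]; [|eauto]. simpl in M2. rewrite <- M2 in A3.
    apply length_zero_iff_nil in A3. rewrite A3 in K. destruct K. }
  destruct Hi as [i0 _].
  assert (K : forall k, exists bc : (V -> {x : nat | (1 <= x <= r)%nat}) *
                                    ({x : nat | (1 <= x <= r)%nat} -> V),
    (forall x, h x = k -> snd bc (fst bc x) = x) /\
    (forall i, h (snd bc i) = k /\ fst bc (snd bc i) = i)).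
  { intros k. destruct (HL k) as [A1 [A2 A3]].
    destruct (list_bijection (L k) m i0 x0) as [b [c [B1 [B2 _]]]]; auto; [congruence|].
    exists (b, c). simpl. split.
    - intros x Hx. apply B1. now apply A2.
    - intros i. destruct (B2 i (M3 i)) as [C1 C2]. split; auto. now apply A2. }
  set (F := fun k => proj1_sig (constructive_indefinite_description _ (K k))).
  assert (HF : forall k, (forall x, h x = k -> snd (F k) (fst (F k) x) = x) /\
            (forall i, h (snd (F k) i) = k /\ fst (F k) (snd (F k) i) = i)).
  { intros k. exact (proj2_sig (constructive_indefinite_description _ (K k))). }
  exists (fun x => (h x, fst (F (h x)) x)). split.
  - exists (fun u => snd (F (fst u)) (snd u)). split.
    + intros x. simpl. now apply HF.
    + intros [k i]. simpl. destruct (HF k) as [_ H]. destruct (H i) as [H1 H2].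
      rewrite H1. now rewrite H2.
  - intros x y. unfold Jarc. simpl. apply Harc.
Qed.

(** * The digraphs J(r) are connected-homogeneous *)

(** Put the entries satisfying [P] first in [l] and their images first in [m]; the remainders have
    equal length and are matched arbitrarily. *)
Lemma partial_bijection_extends {V : Type} (l m : list V) (P : V -> Prop) (f : V -> V) (v0 : V) :
  NoDup l -> NoDup m -> length l = length m ->
  (forall x, In x l -> P x -> In (f x) m) ->
  (forall x y, P x -> P y -> f x = f y -> x = y) ->
  exists b c : V -> V,
    (forall x, In x l -> In (b x) m /\ c (b x) = x) /\
    (forall y, In y m -> In (c y) l /\ b (c y) = y) /\
    (forall x, In x l -> P x -> b x = f x).
Proof.
  intros Hl Hm Hlen Hf Hinj.
  set (p := fun x => if dec (P x) then true else false).
  assert (Hp : forall x, p x = true <-> P x).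
  { intros x. unfold p. destruct (dec (P x)); intuition discriminate. }
  set (l1 := filter p l).
  set (q := fun y => if dec (In y (map f l1)) then true else false).
  assert (Hq : forall y, q y = true <-> In y (map f l1)).
  { intros y. unfold q. destruct (dec (In y (map f l1))); intuition discriminate. }
  assert (N1 : NoDup (map f l1)).
  { apply NoDup_map_NoDup_ForallPairs; [|now apply NoDup_filter].
    intros x y Hx Hy. apply filter_In in Hx, Hy. apply Hinj; apply Hp; tauto. }
  assert (L1 : length (filter q m) = length l1).
  { rewrite <- (length_map f l1). apply Permutation_length, NoDup_Permutation; auto.
    - now apply NoDup_filter.
    - intros y. rewrite filter_In, Hq. split; [tauto|]. intros Hy. split; auto.
      apply in_map_iff in Hy. destruct Hy as [x [<- Hx]]. apply filter_In in Hx.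
      apply Hf; [tauto|]. apply Hp; tauto. }
  pose proof (filter_length p l) as Fl. pose proof (filter_length q m) as Fm.
  set (l2 := filter (fun x => negb (p x)) l) in *.
  set (m2 := filter (fun y => negb (q y)) m) in *.
  assert (In_l : forall x, In x (l1 ++ l2) <-> In x l).
  { intros x. unfold l1, l2. rewrite in_app_iff, !filter_In. destruct (p x); simpl; intuition. }
  assert (In_m : forall y, In y (map f l1 ++ m2) <-> In y m).
  { intros y. unfold m2. rewrite in_app_iff, filter_In. split.
    - intros [H|[H _]]; auto. apply in_map_iff in H. destruct H as [x [<- Hx]].
      apply filter_In in Hx. apply Hf; [tauto|]. apply Hp; tauto.
    - intros H. destruct (q y) eqn:E; [left; now apply Hq|right; auto]. }
  destruct (list_bijection (l1 ++ l2) (map f l1 ++ m2) v0 v0) as [b [c [B1 [B2 B3]]]].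
  - apply NoDup_app; try (now apply NoDup_filter).
    intros x Hx Hx'. apply filter_In in Hx, Hx'. destruct (p x); simpl in *; intuition discriminate.
  - apply NoDup_app; auto; [now apply NoDup_filter|].
    intros y Hy Hy'. apply filter_In in Hy'. apply Hq in Hy. rewrite Hy in Hy'.
    destruct Hy'. discriminate.
  - rewrite !length_app, length_map. fold l1 in Fl. lia.
  - exists b, c. split; [|split].
    + intros x Hx. apply In_l, B1 in Hx. rewrite In_m in Hx. auto.
    + intros y Hy. apply In_m, B2 in Hy. rewrite In_l in Hy. auto.
    + intros x Hx Px. apply B3.
      assert (Hx1 : In x l1) by (apply filter_In; split; auto; now apply Hp).
      clearbody m2 l2. clear - Hx1. clearbody l1. induction l1 as [|a t IH]; [destruct Hx1|].
      destruct Hx1 as [->|Hx1]; [now left|right; auto].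
Qed.

Lemma complete_layers_homogeneous {V : Type} (arc : V -> V -> Prop) (h : V -> Z) r
  (L : Z -> list V) :
  (forall x y, arc x y <-> h y = (h x + 1)%Z) ->
  (forall k, NoDup (L k) /\ (forall v, In v (L k) <-> h v = k) /\ length (L k) = r) ->
  connected_homogeneous arc.
Proof.
  intros Harc HL A B f _ _ CA _ [I1 [I2 [I3 I4]]].
  destruct (classic (exists a, A a)) as [[a0 Ha0]|Hempty].
  2: { exists (fun x => x). split; [apply automorphism_id|]. intros x Hx. exfalso. eauto. }
  set (d := (h (f a0) - h a0)%Z).
  (* Arcs raise the height by 1 and [f] preserves them, so the shift is constant along edges of [A],
     and [A] is connected. *)
  assert (Hd : forall x, A x -> h (f x) = (h x + d)%Z).
  { intros x Hx. specialize (CA a0 x Ha0 Hx). clear Hx. apply clos_rt_rtn1 in CA.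
    induction CA as [|y z [Ay [Az Hyz]] _ IH]; [unfold d; lia|].
    destruct Hyz as [H|H]; pose proof H as H'; apply I4 in H'; auto; apply Harc in H, H'; lia. }
  assert (K : forall k, exists bc : (V -> V) * (V -> V),
    (forall x, h x = k -> h (fst bc x) = (k + d)%Z /\ snd bc (fst bc x) = x) /\
    (forall y, h y = (k + d)%Z -> h (snd bc y) = k /\ fst bc (snd bc y) = y) /\
    (forall x, h x = k -> A x -> fst bc x = f x)).
  { intros k. destruct (HL k) as [L1 [L2 L3]], (HL (k + d)%Z) as [M1 [M2 M3]].
    destruct (partial_bijection_extends (L k) (L (k + d)%Z) A f a0) as [b [c [B1 [B2 B3]]]];
      auto; [congruence| |].
    - intros x Hx Ax. apply M2. rewrite (Hd x Ax). apply L2 in Hx. lia.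
    - exists (b, c). simpl. split; [|split].
      + intros x Hx. apply L2, B1 in Hx. now rewrite M2 in Hx.
      + intros y Hy. apply M2, B2 in Hy. now rewrite L2 in Hy.
      + intros x Hx. apply L2 in Hx. auto. }
  set (F := fun k => proj1_sig (constructive_indefinite_description _ (K k))).
  assert (HF : forall k,
    (forall x, h x = k -> h (fst (F k) x) = (k + d)%Z /\ snd (F k) (fst (F k) x) = x) /\
    (forall y, h y = (k + d)%Z -> h (snd (F k) y) = k /\ fst (F k) (snd (F k) y) = y) /\
    (forall x, h x = k -> A x -> fst (F k) x = f x)).
  { intros k. exact (proj2_sig (constructive_indefinite_description _ (K k))). }
  assert (Hg : forall x, h (fst (F (h x)) x) = (h x + d)%Z) by (intros x; now apply HF).
  exists (fun x => fst (F (h x)) x). split; [split|].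
  (* The preimage of [y] lies [d] layers lower, which selects the layer bijection to invert. *)
  - exists (fun y => snd (F (h y - d)%Z) y). split.
    + intros x. rewrite Hg. replace (h x + d - d)%Z with (h x) by lia. now apply HF.
    + intros y. destruct (HF (h y - d)%Z) as [_ [H _]]. destruct (H y) as [H1 H2]; [lia|].
      rewrite H1. exact H2.
  - intros x y. rewrite !Harc, !Hg. lia.
  - intros x Hx. now apply HF.
Qed.

Lemma isomorphic_J_homogeneous {V : Type} (arc : V -> V -> Prop) r :
  isomorphic arc (Jarc r) -> connected_homogeneous arc.
Proof.
  intros [f [[g [G1 G2]] Hf]]. destruct (interval_enum r) as [m [M1 [M2 M3]]].
  apply (complete_layers_homogeneous arc (fun x => fst (f x)) r
           (fun k => map (fun i => g (k, i)) m)).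
  - exact Hf.
  - intros k. split; [|split].
    + apply FinFun.Injective_map_NoDup; auto. intros i j E.
      apply (f_equal f) in E. rewrite !G2 in E. congruence.
    + intros v. rewrite in_map_iff. split.
      * intros [i [<- _]]. now rewrite G2.
      * intros <-. exists (snd (f v)). split; auto. rewrite <- surjective_pairing. apply G1.
    + now rewrite length_map.
Qed.

Theorem theorem6p2 (V : Type) (arc : V -> V -> Prop) :
  is_digraph arc -> connected arc -> locally_finite arc -> has_exactly_two_ends arc ->
  (connected_homogeneous arc <-> exists r : nat, isomorphic arc (Jarc r)).
Proof.
  intros Hdig Hconn Hlf Hends. split.
  - intros Hch.
    destruct (layering_exists arc Hdig Hconn Hlf Hch Hends) as [h [Hh Hfin]].
    pose proof (homogeneous_in_neighbour arc Hdig Hch Hends) as Hin.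
    pose proof (homogeneous_out_neighbour arc Hdig Hch Hends) as Hout.
    destruct (layer_enum arc h Hdig Hconn Hch Hh Hfin Hin Hout) as [r [L HL]].
    destruct (two_ended_has_arc arc Hends) as [x0 _].
    exists r. apply (complete_layers_isomorphic arc h r L x0); auto.
    intros x y. split; [apply Hh|].
    now apply (layers_complete arc h Hdig Hconn Hlf Hch Hh Hfin Hin Hout).
  - intros [r Hr]. now apply isomorphic_J_homogeneous with r.
Qed.
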